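(* There exists a numerical constant $C>0$ such that $\min_{\tilde{\mathcal A}_\delta}\tilde E_h\le Ch^{5/3}$ for all $h\in(0,1/2]$ and all $\delta\in[0,1/2]$.
   Context: Let $B_1=\{x\in\mathbb R^2:|x|<1\}$ and $\hat x^\perp=(-x_2,x_1)/|x|$. For $h>0$ define $\tilde E_h:W^{1,2}(B_1;\mathbb R^2)\times W^{2,2}(B_1)\to\mathbb R$ by \[ \tilde E_h(U,W)=\int_{B_1}\big|DU+DU^T+DW\otimes DW+\hat x^\perp\otimes\hat x^\perp\big|^2+h^2|D^2W|^2\,dx . \] For $\delta$ let $\tilde{\mathcal A}_\delta=\{(U,W)\in W^{1,2}(B_1;\mathbb R^2)\times W^{2,2}(B_1): W(0)=0,\ |W|\le 1-\delta \text{ on }\partial B_1\}$. *)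

(* Defs.v *)
From mathcomp Require Import all_boot all_order all_algebra.
From mathcomp Require Import all_classical all_reals all_analysis.
Import Order.TTheory GRing.Theory Num.Theory numFieldNormedType.Exports.

Set Implicit Arguments.
Unset Strict Implicit.
Unset Printing Implicit Defensive.

Local Open Scope classical_set_scope.
Local Open Scope ring_scope.

Section Defs.
Variable R : realType.

Definition leb2 := ((@lebesgue_measure R) \x (@lebesgue_measure R))%E.

Definition sqn (x : R * R) : R := x.1 ^+ 2 + x.2 ^+ 2.
Definition enorm (x : R * R) : R := Num.sqrt (sqn x).

Definition B1 : set (R * R) := [set x | sqn x < 1].
Definition cB1 : set (R * R) := [set x | sqn x <= 1].
Definition S1 : set (R * R) := [set x | sqn x = 1].

Definition edir (i : 'I_2) : R * R := if i == ord0 then (1, 0) else (0, 1).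

Definition pd (i : 'I_2) (f : R * R -> R) : R * R -> R := 'D_(edir i) f.

Fixpoint iterpd (s : seq 'I_2) (f : R * R -> R) : R * R -> R :=
  match s with
  | [::] => f
  | i :: s' => pd i (iterpd s' f)
  end.

Definition smooth (f : R * R -> R) : Prop :=
  forall s : seq 'I_2,
    continuous (iterpd s f) /\
    (forall (i : 'I_2) (x : R * R), derivable (iterpd s f) x (edir i)).

Definition test_fun (phi : R * R -> R) : Prop :=
  smooth phi /\
  exists r : R, 0 < r < 1 /\ (forall x, r ^+ 2 <= sqn x -> phi x = 0).

Definition L2B1 (f : R * R -> R) : Prop :=
  measurable_fun B1 f /\ (\int[leb2]_(x in B1) ((f x) ^+ 2)%:E < +oo)%E.

Definition weak_pd (i : 'I_2) (f g : R * R -> R) : Prop :=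
  forall phi, test_fun phi ->
    (\int[leb2]_(x in B1) (f x * pd i phi x)%:E
     = - \int[leb2]_(x in B1) (g x * phi x)%:E)%E.

Definition weak_grad_L2 (f : R * R -> R) (Df : 'I_2 -> R * R -> R) : Prop :=
  forall i, L2B1 (Df i) /\ weak_pd i f (Df i).

Definition W12 (f : R * R -> R) (Df : 'I_2 -> R * R -> R) : Prop :=
  L2B1 f /\ weak_grad_L2 f Df.

Definition W22 (f : R * R -> R) (Df : 'I_2 -> R * R -> R)
    (D2f : 'I_2 -> 'I_2 -> R * R -> R) : Prop :=
  L2B1 f /\ weak_grad_L2 f Df /\ (forall i, weak_grad_L2 (Df i) (D2f i)).

Definition xperp (x : R * R) (i : 'I_2) : R :=
  (if i == ord0 then - x.2 else x.1) / enorm x.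

(* the energy tilde E_h(U,W), written through the weak derivatives:
   DU i j = d_j U_i (so (DU^T) i j = DU j i), DW i = d_i W, D2W i j = d_j d_i W *)
Definition Etilde (h : R) (DU : 'I_2 -> 'I_2 -> R * R -> R)
    (DW : 'I_2 -> R * R -> R) (D2W : 'I_2 -> 'I_2 -> R * R -> R) : \bar R :=
  (\int[leb2]_(x in B1)
     (\sum_(i < 2) \sum_(j < 2)
         (DU i j x + DU j i x + DW i x * DW j x + xperp x i * xperp x j) ^+ 2
      + h ^+ 2 * \sum_(i < 2) \sum_(j < 2) (D2W i j x) ^+ 2)%:E)%E.

(* the constraints of tilde A_delta on W in W^{2,2}(B1): W^{2,2}(B1) functions
   in 2D have a (unique) continuous representative on the closed disk; W(0) and
   the boundary values refer to it. *)
Definition W_admissible (delta : R) (W : R * R -> R) : Prop :=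
  exists Wc : R * R -> R,
    {within cB1, continuous Wc} /\
    {ae leb2, forall x, B1 x -> W x = Wc x} /\
    Wc (0, 0) = 0 /\
    (forall x, S1 x -> `|Wc x| <= 1 - delta).

End Defs.

(* Main.v *)
Require Import Defs.
From mathcomp Require Import all_boot all_order all_algebra.
From mathcomp Require Import all_classical all_reals all_analysis.
From mathcomp Require Import measurable_realfun.
From mathcomp Require Import ring lra.
Import Order.TTheory GRing.Theory Num.Theory numFieldNormedType.Exports.
Local Open Scope classical_set_scope.
Local Open Scope ring_scope.

(** Away from the origin the membrane term can be made to vanish exactly when
    the distributional Hessian determinant of [W] is [pi] times the Dirac mass
    at [0].  The boundary condition only asks for [|W| <= 1/2] on the circle,
    and this can be reached without any ridge.  Let [W] be the support function
    of a lens-shaped convex body of area [pi], long in the [x_1] direction: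
    it is [1]-homogeneous, small near the [x_2] axis and, because of the two
    corners of the lens, equal to [a |x_1|] on two wide sectors.  In these
    sectors [W] depends on [x_1] only, so it may be flattened there as a function
    of [x_1], at the price of a correction of [U_1] depending on [x_1] only.
    Cutting off the tip at scale [h] costs [O(h^2)] of membrane energy, and the
    bending density is [O(h^2 / |x|^2)]; a decomposition of the disk along the
    powers of [h^(1/6)] turns this into [O(h^(5/3))]. *)

(** A 1-homogeneous [W] is not enough: a support function with values at most 1 on the circle
    belongs to a convex body inside the unit disk, and only the disk itself then has area [pi]. So
    the lens exceeds the bound in its long direction and must be flattened before the boundary is
    reached. Flattening a curved part would create new Hessian determinant, while flattening a
    function of [x_1] alone creates none. The construction therefore rests on a comparison of
    heights: outside the two sectors the lens is at most [8 b |x_2|], so inside the disk the level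
    [8 b], where the flattening sets in, is met only in the sectors. The parameter [b] is taken
    small to bound the final height, and the elongation [m] follows from the area condition. The
    displacement depends neither on [h] nor on [delta]; [W] depends on [h] through its tip only. *)

(** * Measurability and partial derivatives in the plane *)

Section Plane.
Context {R : realType}.
Implicit Types (f g : R * R -> R) (x y : R * R) (i : 'I_2).

(** Measurability on [R * R] refers to the product sigma-algebra; an open set lies in it as a
    countable union of squares with rational centres. *)
Lemma open_measurable2 (A : set (R * R)) : open A -> measurable A.
Proof.
move=> oA.
pose box (p : rat * rat) (n : nat) : set (R * R) :=
  ball (ratr p.1 : R) n.+1%:R^-1 `*` ball (ratr p.2 : R) n.+1%:R^-1.
pose F (a b : rat) (n : nat) :=
  if pselect (box (a, b) n `<=` A) then box (a, b) n else set0.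
suff -> : A = \bigcup_(a : rat) \bigcup_(b : rat) \bigcup_n F a b n.
  apply: bigcupT_measurable_rat => a; apply: bigcupT_measurable_rat => b.
  apply: bigcupT_measurable => n; rewrite /F; case: pselect => //= ?.
  by apply: measurableX; exact: measurable_ball.
apply/seteqP; split => [[x y] Axy|]; last first.
  move=> x [a _ [b _ [n _]]].
  by rewrite /F; case: pselect => //= H; exact: H.
have /nbhs_ballP[e /= e0 eA] : nbhs (x, y) A by exact: open_nbhs_nbhs.
have [n ne] : exists n : nat, n.+1%:R^-1 < e / 2.
  exists (Num.truncn (e / 2)^-1).
  rewrite invf_plt ?posrE ?divr_gt0 //.
  by rewrite truncnS_gt.
have n0 : 0 < n.+1%:R^-1 :> R by rewrite invr_gt0.
have ne2 : n.+1%:R^-1 + n.+1%:R^-1 < e by rewrite (splitr e) ltrD.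
have H (z : R) : exists a : rat, `|ratr a - z| < n.+1%:R^-1.
  have zz : z < z + n.+1%:R^-1 by rewrite ltrDl.
  have [a] := rat_in_itvoo zz; rewrite in_itv /= => /andP[za az].
  by exists a; rewrite gtr0_norm ?subr_gt0 // ltrBlDl.
have [a xa] := H x; have [b yb] := H y.
exists a => //; exists b => //; exists n => //; rewrite /F.
case: pselect => /= [?|H']; first by split; rewrite /= /ball /=.
exfalso; apply: H' => -[u v] /= [ua vb]; apply: eA.
rewrite /ball/= in ua vb *; split; rewrite /ball /=.
  have -> : x - u = - (ratr a - x) + (ratr a - u) by ring.
  rewrite (le_lt_trans (ler_normD _ _)) // normrN.
  by rewrite (lt_trans (ltrD xa ua)).
have -> : y - v = - (ratr b - y) + (ratr b - v) by ring.
rewrite (le_lt_trans (ler_normD _ _)) // normrN.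
by rewrite (lt_trans (ltrD yb vb)).
Qed.

Lemma continuous_measurable2 f : continuous f -> measurable_fun setT f.
Proof.
move=> cf; apply: (measurability _ (RGenOInfty.measurableE R)) => //.
move=> _ [_ [r ->] <-]; rewrite setTI.
by apply: open_measurable2; apply: open_comp => // ? _; exact: cf.
Qed.

Definition line (i : 'I_2) (x : R * R) (t : R) : R * R :=
  if i == ord0 then (t, x.2) else (x.1, t).
Definition crd (i : 'I_2) (x : R * R) : R := if i == ord0 then x.1 else x.2.

Lemma line_crd i x : line i x (crd i x) = x.
Proof. by rewrite /line /crd; case: x => a b; case: (i == ord0). Qed.

Lemma shift_line i x t : t *: edir R i + x = line i x (t + crd i x).
Proof.
rewrite /line /crd /edir; case: x => a b; case: (i == ord0) => /=.
  by apply: injective_projections; rewrite /= /GRing.scale /= ?mulr1 ?mulr0 ?add0r.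
by apply: injective_projections; rewrite /= /GRing.scale /= ?mulr1 ?mulr0 ?add0r.
Qed.

(** The two difference quotients are the same function. Through this equivalence, differentiation in
    the plane takes place on coordinate lines. *)
Lemma is_derive_line i f x d :
  is_derive (crd i x) 1 (fun t => f (line i x t)) d <->
  is_derive x (edir R i) f d.
Proof.
have E : (fun h : R => h^-1 *: ((f \o shift x) (h *: edir R i) - f x)) =
  (fun h : R => h^-1 *: (((fun t => f (line i x t)) \o shift (crd i x)) (h *: (1 : R))
     - f (line i x (crd i x)))).
  by apply/funext => h /=; rewrite line_crd shift_line /GRing.scale /= mulr1.
by split => -[H1 H2]; split; move: H1 H2; rewrite /derivable /derive E.
Qed.

End Plane.

(** * Integrals of derivatives on the line *)

Section OneDim.
Context {R : realType}.
Notation leb := (@lebesgue_measure R).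

Lemma integral_support d (T : measurableType d) (mu : {measure set T -> \bar R})
    (A : set T) (f : T -> \bar R) :
  (forall x, ~ A x -> f x = 0%E) -> (\int[mu]_(x in A) f x = \int[mu]_x f x)%E.
Proof.
move=> f0; rewrite integral_mkcond; congr integral.
apply/funext => x; rewrite /patch; case: ifPn => //.
by rewrite notin_setE => /f0.
Qed.

Lemma mvt_bound (f df : R -> R) (M : R) :
  (forall x : R, is_derive x (1 : R) f (df x)) -> (forall x, `|df x| <= M) ->
  forall x y, `|f x - f y| <= M * `|x - y|.
Proof.
move=> fdf dM.
suff H x y : x <= y -> `|f x - f y| <= M * `|x - y|.
  move=> x y; case: (leP x y) => [xy|/ltW xy]; first exact: H.
  by rewrite distrC (distrC x); exact: H.
move=> xy; have [] := @MVT_segment R f df x y xy.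
- apply: continuous_subspaceT => z; apply: differentiable_continuous.
  by apply/derivable1_diffP; have [] := fdf z.
move=> c _; rewrite distrC => ->; rewrite normrM (distrC x).
by rewrite ler_wpM2r.
Qed.

Lemma is_derive_continuous (f df : R -> R) :
  (forall x : R, is_derive x (1 : R) f (df x)) -> continuous f.
Proof.
move=> fdf z; apply: differentiable_continuous.
by apply/derivable1_diffP; have [] := fdf z.
Qed.

(** Along [harmonic] the derivative becomes the limit of a sequence, as measurability and dominated
    convergence require. *)
Lemma is_derive_quotient_cvg (f : R -> R) (x d : R) : is_derive x (1 : R) f d ->
  (harmonic n)^-1 * (f (x + harmonic n) - f x) @[n --> \oo] --> d.
Proof.
move=> [+ <-]; rewrite /derivable /derive => /cvgr_dnbhsP/(_ harmonic) H.
have : (forall n, @harmonic R n != 0) /\ @harmonic R n @[n --> \oo] --> 0.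
  by split=> [n|]; [rewrite /harmonic /= invr_eq0 pnatr_eq0|exact: cvg_harmonic].
move=> /H; apply: cvg_trans; apply: near_eq_cvg; apply: nearW => n.
by rewrite /= /GRing.scale /= mulr1 (addrC _ x).
Qed.

(** Change of variables on [[-3, 3]], which contains the supports of [G] and of its translate with
    room to spare. *)
Lemma integral_translation (G : R -> R) (t : R) : continuous G ->
  (forall x, 1 < `|x| -> G x = 0) -> 0 <= t <= 1 ->
  (\int[leb]_x (G (x + t))%:E = \int[leb]_x (G x)%:E)%E.
Proof.
move=> cG G0 /andP[t0 t1].
pose F := shift t : R -> R.
have dF (x : R) : is_derive x (1 : R) F 1 by exact: is_derive_shift.
have F1 : (F^`())%classic = fun=> 1.
  by apply/funext => x; rewrite derive1E; have [] := dF x.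
have -> : (\int[leb]_x (G x)%:E = \int[leb]_(x in `[F (-3)%R, F 3%R]) (G x)%:E)%E.
  symmetry; apply: integral_support => x /=; rewrite in_itv /= /F /= => /negP.
  rewrite negb_and -!ltNge => xt; rewrite G0 //.
  by case/orP: xt => xt; [rewrite ltr0_norm|rewrite gtr0_norm]; lra.
rewrite integration_by_substitution_increasing.
- rewrite -(@integral_support _ _ leb `[(-3)%R, 3%R]) => [|x /=].
    by apply: eq_integral => x _; rewrite F1 /= fctE mulr1.
  rewrite in_itv /= -ler_norml => /negP; rewrite -ltNge => x3.
  rewrite G0 //; have := ler_normB (x + t) t; rewrite addrK (ger0_norm t0); lra.
- lra.
- by move=> x y _ _; rewrite /F /= ltrD2r.
- by rewrite F1 => x _; exact: cvg_cst.
- by rewrite F1; exact: is_cvg_cst.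
- by rewrite F1; exact: is_cvg_cst.
- have cF := is_derive_continuous _ _ dF.
  split.
  + by move=> x _; have [] := dF x.
  + by apply: cvg_at_right_filter; exact: cF.
  + by apply: cvg_at_left_filter; exact: cF.
- exact: continuous_subspaceT.
Qed.

(* No continuity of [g] is needed: the difference quotients have integral [0]
   and are dominated by the Lipschitz constant. *)
Lemma integral_derive_eq0 (G g : R -> R) (M : R) :
  (forall x : R, is_derive x (1 : R) G (g x)) -> (forall x, `|g x| <= M) ->
  (forall x, 1 < `|x| -> G x = 0) -> (\int[leb]_x (g x)%:E = 0)%E.
Proof.
move=> Gg gM G0.
have cG := is_derive_continuous _ _ Gg.
have g0 x : 1 < `|x| -> g x = 0.
  move=> x1; have [_ <-] : is_derive x (1 : R) G 0.
    apply: (@near_eq_is_derive _ _ _ (cst 0)).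
    near=> y; rewrite /cst G0 //; near: y.
    exact: (cvgr_gt _ (@norm_continuous _ _ x)).
  by have [_ <-] := Gg x.
pose e : nat -> R := harmonic.
have e01 n : 0 < e n <= 1 by rewrite /e invr_gt0 ltr0n /= invf_le1 // ler1n.
pose q n x := (e n)^-1 * (G (x + e n) - G x).
have cq n : continuous (q n).
  move=> x; apply: cvgM; first exact: cvg_cst.
  apply: cvgB; last exact: cG.
  by apply: continuous_comp; [apply: cvgD; [exact: cvg_id|exact: cvg_cst]|exact: cG].
have q_cvg x : q n x @[n --> \oo] --> g x.
  exact: is_derive_quotient_cvg.
have mq n : measurable_fun setT (q n) by exact: continuous_measurable_fun.
have mg : measurable_fun setT g by apply: (measurable_fun_cvg mq) => x _; exact: q_cvg.
have qM n x : `|q n x| <= M.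
  have /andP[en0 _] := e01 n.
  rewrite /q normrM gtr0_norm ?invr_gt0 // mulrC ler_pdivrMr //.
  by rewrite (le_trans (mvt_bound _ _ M Gg gM _ _)) // addrAC subrr add0r gtr0_norm.
have M0 : `|M| <= M by rewrite ger0_norm // (le_trans _ (gM 0)).
pose D := `[-3%R, 3%R]%classic : set R.
have mD : measurable D by exact: measurable_itv.
have outD x : ~ D x -> 3 < `|x|.
  by rewrite /D /= in_itv /= -ler_norml => /negP; rewrite -ltNge.
have q0 n : (\int[leb]_(x in D) (q n x)%:E = 0)%E.
  have cGe : continuous (fun x => G (x + e n)).
    by move=> x; apply: continuous_comp; [apply: cvgD; [exact: cvg_id|exact: cvg_cst]|exact: cG].
  have iG (H : R -> R) : continuous H -> leb.-integrable D (EFin \o H).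
    move=> cH; apply: continuous_compact_integrable; first exact: segment_compact.
    exact: continuous_subspaceT.
  under eq_integral do rewrite EFinM EFinB.
  rewrite integralZl //; last first.
    by apply: (iG (fun x => G (x + e n) - G x)) => x; apply: cvgB; [exact: cGe|exact: cG].
  rewrite integralB_EFin //; [|exact: (iG (fun x => G (x + e n)))|exact: iG].
  have /andP[en0 en1] := e01 n.
  have GD x : ~ D x -> (G x)%:E = 0%E by move=> /outD x3; rewrite G0 //; lra.
  rewrite (@integral_support _ _ leb D (fun x => (G (x + e n))%:E)) => [|x /outD x3].
    rewrite integral_translation //; last by rewrite ltW.
    rewrite -(@integral_support _ _ leb D) // subee ?mule0 //.
    by apply: integrable_fin_num => //; exact: iG.
  rewrite G0 //.
  have := ler_normB (x + e n) (e n); rewrite addrK (gtr0_norm en0); lra.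
rewrite -(@integral_support _ _ leb D) => [|x /outD x3]; last first.
  by rewrite g0 //; lra.
have := @dominated_convergence _ _ _ leb D mD (fun n x => (q n x)%:E)
  (fun x => (g x)%:E) (fun=> M%:E).
case.
- by move=> n; apply/measurable_EFinP; apply: measurable_funTS; exact: mq.
- by apply/measurable_EFinP; apply: measurable_funTS; exact: mg.
- by apply: aeW => x _; apply: cvg_EFin; [exact: nearW|exact: q_cvg].
- apply: (@measurable_bounded_integrable _ _ _ _ (fun=> M)) => //.
  + apply: compact_finite_measure; exact: segment_compact.
  + by exists M; split => [|y My x _]; [exact: num_real|exact: (le_trans M0 (ltW My))].
- by apply: aeW => x n _; rewrite lee_fin.
move=> _ _; under eq_fun do rewrite q0.
by move=> /(cvg_unique _ (cvg_cst _)) ->.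
Unshelve. all: by end_near. Qed.

End OneDim.

(** * Sobolev functions with bounded classical partial derivatives *)

Section Sobolev.
Context {R : realType}.
Implicit Types (f g : R * R -> R) (x y : R * R) (i : 'I_2).
Notation leb := (@lebesgue_measure R).

Lemma sqn_line i x t : sqn (line i x t) = t ^+ 2 + crd (if i == ord0 then ord_max else ord0) x ^+ 2.
Proof. by rewrite /sqn /line /crd; case: (i == ord0) => //=; rewrite addrC. Qed.

Lemma sqn_continuous : continuous (@sqn R).
Proof.
move=> x; apply: cvgD.
  by apply: (@cvgM _ _ _ _ fst fst); exact: cvg_fst.
by apply: (@cvgM _ _ _ _ snd snd); exact: cvg_snd.
Qed.

Lemma measurable_B1 : measurable (@B1 R).
Proof.
apply: open_measurable2; rewrite /B1.
apply: (@open_comp _ _ (@sqn R) [set t | t < 1]); last exact: open_lt.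
by move=> x _; exact: sqn_continuous.
Qed.

Lemma B1_box x : B1 x -> `|x.1| <= 1 /\ `|x.2| <= 1.
Proof.
case: x => a b; rewrite /B1 /sqn /= => H.
have := sqr_ge0 a; have := sqr_ge0 b => b0 a0.
rewrite -(ler_pXn2r (ltn0Sn 1)) ?nnegrE // -(ler_pXn2r (ltn0Sn 1) (normr_ge0 b)) ?nnegrE //.
by rewrite !real_normK ?num_real // expr1n; split; lra.
Qed.

Definition box (r : R) : set (R * R) := `[-r, r]%classic `*` `[-r, r]%classic.

Lemma measurable_box r : measurable (box r).
Proof. by apply: measurableX; exact: measurable_itv. Qed.

Lemma boxP r x : box r x <-> `|x.1| <= r /\ `|x.2| <= r.
Proof. by rewrite /box /= !in_itv /= -!ler_norml. Qed.

Lemma leb2_box r : 0 <= r -> @leb2 R (box r) = (4 * r ^+ 2)%:E.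
Proof.
move=> r0; rewrite /leb2 product_measure1E; [|exact: measurable_itv|exact: measurable_itv].
have E : leb `[- r, r]%classic = (r + r)%:E.
  rewrite (lebesgue_measure_itv `[-r, r]) /= lte_fin; case: ltP => r1.
    by rewrite -EFinB opprK.
  by congr EFin; lra.
transitivity ((r + r)%:E * (r + r)%:E)%E; first by congr (_ * _)%E; exact: E.
by rewrite -EFinM; congr EFin; ring.
Qed.

Lemma leb2_B1 : (@leb2 R (@B1 R) < +oo)%E.
Proof.
apply: (@le_lt_trans _ _ (@leb2 R (box 1))); last by rewrite leb2_box // ltry.
apply: le_measure; rewrite ?inE; [exact: measurable_B1|exact: measurable_box|].
by move=> x /B1_box /boxP.
Qed.

Lemma integrable_bounded_B1 f (K : R) : measurable_fun setT f ->
  (forall x, B1 x -> `|f x| <= K) -> (@leb2 R).-integrable (@B1 R) (EFin \o f).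
Proof.
move=> mf fK; apply: measurable_bounded_integrable.
- exact: measurable_B1.
- exact: leb2_B1.
- exact: measurable_funTS.
- exists K; split => [|y Ky x /= /fK H]; first exact: num_real.
  exact: (le_trans H (ltW Ky)).
Qed.

Lemma L2B1_bounded f (K : R) : measurable_fun setT f ->
  (forall x, B1 x -> `|f x| <= K) -> L2B1 f.
Proof.
move=> mf fK; split; first exact: measurable_funTS.
have := @integrable_bounded_B1 (fun x => f x ^+ 2) (K ^+ 2).
case/(_ _ _)/integrableP => [|x Bx|_].
- exact: measurable_funX.
- by rewrite normrX lerXn2r ?nnegrE // ?fK // (le_trans _ (fK _ Bx)).
- by under eq_integral do rewrite /= ger0_norm ?sqr_ge0 //.
Qed.

(* Fubini reduces the claim to [integral_derive_eq0] on each line. *)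
Lemma integral_pd_eq0 i (F g : R * R -> R) (M : R) :
  (forall x, is_derive x (edir R i) F (g x)) -> (forall x, `|g x| <= M) ->
  measurable_fun setT g ->
  (forall x, ~ B1 x -> F x = 0) -> (forall x, ~ B1 x -> g x = 0) ->
  (\int[@leb2 R]_x (g x)%:E = 0)%E.
Proof.
move=> Fg gM mg F0 g0.
have ig : (@leb2 R).-integrable setT (EFin \o g).
  apply/integrableP; split; first exact/measurable_EFinP.
  rewrite -(@integral_support _ _ _ (@leb2 R) (@B1 R)) => [|x /g0 /= ->]; last by rewrite normr0.
  by have /integrableP[] := @integrable_bounded_B1 g M mg (fun x _ => gM x).
have out1 x t : 1 < `|t| -> F (line i x t) = 0.
  move=> t1; apply: F0; rewrite /B1 /= sqn_line => H.
  have := sqr_ge0 (crd (if i == ord0 then ord_max else ord0) x).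
  have : 1 < t ^+ 2 by rewrite -(real_normK (num_real t)) exprn_egt1.
  by lra.
have L1 x : (\int[leb]_t (g (line i x t))%:E = 0)%E.
  apply: (@integral_derive_eq0 _ (fun t => F (line i x t)) _ M) => [t|t|t /out1 //].
    have /is_derive_line := Fg (line i x t).
    suff -> : crd i (line i x t) = t.
      suff -> : line i (line i x t) = line i x by [].
      by apply/funext => s; rewrite /line; case: (i == ord0).
    by rewrite /crd /line; case: (i == ord0).
  exact: gM.
have [i0|i0] := eqVneq i ord0.
  rewrite -integral21_prod_meas1 // integral0_eq // => y _.
  rewrite /fubini_G; have := L1 (0, y); by rewrite /line i0.
rewrite -integral12_prod_meas1 // integral0_eq // => y _.
rewrite /fubini_F; have := L1 (y, 0); by rewrite /line (negbTE i0).
Qed.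

Lemma bounded_of_support f : continuous f -> (forall x, ~ B1 x -> f x = 0) ->
  exists K, forall x, `|f x| <= K.
Proof.
move=> cf f0.
have cB : compact (box 1) by apply: compact_setX; exact: segment_compact.
have [||c _ cmax] := @compact_EVT_max _ R (fun x => `|f x|) (box 1) _ cB.
- by exists (0, 0); apply/boxP; rewrite /= normr0.
- apply: continuous_subspaceT => x; apply: continuous_comp; first exact: cf.
  exact: norm_continuous.
exists `|f c| => x; have [Bx|/f0 ->] := pselect (B1 x); last by rewrite normr0.
by apply: cmax; rewrite inE; apply/boxP; exact: B1_box.
Qed.

(** One moves from [x] to [y] along the two coordinate directions. Continuity of the partial
    derivatives is deliberately not assumed: those of the displacement built below have no limit at
    the origin. *)
Lemma pd_bounded_lipschitz f (M : R) :
  (forall i x, derivable f x (edir R i)) -> (forall i x, `|pd i f x| <= M) ->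
  forall x y, `|f x - f y| <= M * (`|x.1 - y.1| + `|x.2 - y.2|).
Proof.
move=> df dM x y.
have L i z s t : `|f (line i z s) - f (line i z t)| <= M * `|s - t|.
  apply: (@mvt_bound _ (fun u => f (line i z u)) (fun u => pd i f (line i z u))).
    move=> u; have /derivableP/is_derive_line := df i (line i z u).
    suff -> : crd i (line i z u) = u.
      suff -> : line i (line i z u) = line i z by [].
      by apply/funext => v; rewrite /line; case: (i == ord0).
    by rewrite /crd /line; case: (i == ord0).
  by move=> u; exact: dM.
have -> : f x - f y = (f x - f (y.1, x.2)) + (f (y.1, x.2) - f y) by ring.
rewrite (le_trans (ler_normD _ _)) // mulrDr lerD //.
  by have := L ord0 x x.1 y.1; rewrite /line /= -surjective_pairing.
by have := L ord_max y x.2 y.2; rewrite /line /= -surjective_pairing.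
Qed.

Lemma pd_bounded_continuous f (M : R) :
  (forall i x, derivable f x (edir R i)) -> (forall i x, `|pd i f x| <= M) ->
  continuous f.
Proof.
move=> df dM x; apply/cvgrPdist_le => e e0.
have M0 : 0 <= M by rewrite (le_trans _ (dM ord0 0)).
have d0 : 0 < e / (2 * (M + 1)) by rewrite divr_gt0 // mulr_gt0 //; lra.
near=> y.
rewrite (le_trans (@pd_bounded_lipschitz f M df dM x y)) //.
have xy : `|x - y| < e / (2 * (M + 1)).
  by near: y; exact: cvgr_dist_lt.
move: xy; rewrite /Num.norm /= gt_max => /andP[x1 x2].
rewrite (le_trans (ler_wpM2l M0 (ltW (ltrD x1 x2)))) //.
have -> : M * (e / (2 * (M + 1)) + e / (2 * (M + 1))) = e * (M / (M + 1)).
  by field; lra.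
rewrite ger_pMr // ler_pdivrMr; lra.
Unshelve. all: by end_near. Qed.

Lemma pd_measurable i f : measurable_fun setT f ->
  (forall x, derivable f x (edir R i)) -> measurable_fun setT (pd i f).
Proof.
move=> mf df.
apply: (@measurable_fun_cvg _ _ _ _ (fun n x => (harmonic n)^-1 * (f (line i x (crd i x + harmonic n)) - f x))).
  move=> n; apply: measurable_funM; first exact: measurable_cst.
  apply: measurable_funB => //; apply: measurableT_comp => //.
  rewrite /line /crd; case: (i == ord0); apply: measurable_fun_pair => /=;
    rewrite ?measurable_fst ?measurable_snd //;
    by apply: measurable_funD; rewrite ?measurable_fst ?measurable_snd //; exact: measurable_cst.
move=> x _.
have /derivableP/is_derive_line/is_derive_quotient_cvg := df x.
by rewrite line_crd.
Qed.

(* The product rule turns the weak derivative identity into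
   [integral_pd_eq0] for [f * phi]. *)
Lemma W12_pd_bounded f (M : R) :
  (forall i x, derivable f x (edir R i)) -> (forall i x, `|pd i f x| <= M) ->
  W12 f (fun i => pd i f).
Proof.
move=> df dM.
have cf := pd_bounded_continuous _ _ df dM.
have mf := continuous_measurable2 _ cf.
have M0 : 0 <= M by rewrite (le_trans _ (dM ord0 0)).
have mpd i : measurable_fun setT (pd i f) by apply: pd_measurable.
have fK x : B1 x -> `|f x| <= `|f 0| + M * 2.
  move=> /B1_box[x1 x2]; have -> : f x = f 0 + (f x - f 0) by ring.
  rewrite (le_trans (ler_normD _ _)) // lerD2l.
  rewrite (le_trans (@pd_bounded_lipschitz f M df dM x 0)) //.
  by rewrite ler_wpM2l // !subr0; lra.
split; first exact: L2B1_bounded fK.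
move=> i; split; first by apply: (@L2B1_bounded _ M) => // x _; exact: dM.
move=> phi [sm [r [/andP[r0 r1] phi0]]].
have [cphi dphi] := sm [::]; have [cdphi _] := sm [:: i].
rewrite /= in cphi dphi cdphi.
have r21 : r ^+ 2 < 1 by rewrite expr_lt1 // ltW.
have p0 x : ~ B1 x -> phi x = 0.
  by rewrite /B1 /= => /negP; rewrite -leNgt => x1; apply: phi0; rewrite (le_trans (ltW r21)).
(* Since [r < 1], [phi] vanishes on a whole neighbourhood of each point outside [B1], so its
   derivative vanishes there too. *)
have dp0 x : ~ B1 x -> pd i phi x = 0.
  rewrite /B1 /= => /negP; rewrite -leNgt => x1.
  have [_ <-] : is_derive x (edir R i) phi 0 => //.
  apply: (@near_eq_is_derive _ _ _ (cst 0)).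
  near=> y; rewrite /cst phi0 // ltW //; near: y.
  by apply: (cvgr_gt _ (sqn_continuous x)); exact: lt_le_trans x1.
have [K1 phiK] := bounded_of_support _ cphi p0.
have [K2 dphiK] := bounded_of_support _ cdphi dp0.
have mphi := continuous_measurable2 _ cphi.
have mdphi := continuous_measurable2 _ cdphi.
have m1 : measurable_fun setT (fun x => f x * pd i phi x) by exact: measurable_funM.
have m2 : measurable_fun setT (fun x => pd i f x * phi x) by exact: measurable_funM.
pose K := (`|f 0| + M * 2) * K2.
have b1 x : B1 x -> `|f x * pd i phi x| <= K.
  by move=> Bx; rewrite normrM ler_pM // fK.
have b2 x : `|pd i f x * phi x| <= M * K1 by rewrite normrM ler_pM.
have i1 := integrable_bounded_B1 _ _ m1 b1.
have i2 := integrable_bounded_B1 _ _ m2 (fun x _ => b2 x).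
have S : (\int[@leb2 R]_(x in @B1 R) (f x * pd i phi x)%:E +
          \int[@leb2 R]_(x in @B1 R) (pd i f x * phi x)%:E = 0)%E.
  rewrite -integralD //; last exact: measurable_B1.
  rewrite integral_support => [|x Bx]; last by rewrite dp0 // p0 // !mulr0 -EFinD addr0.
  under eq_integral do rewrite -EFinD.
  apply: (@integral_pd_eq0 i (fun x => f x * phi x) _ (K + M * K1)).
  - move=> x; have /derivableP fx := df i x; have /derivableP px := dphi i x.
    apply: (is_derive_eq (is_deriveM fx px)).
    by rewrite /GRing.scale /= [phi x * _]mulrC.
  - move=> x; rewrite (le_trans (ler_normD _ _)) // lerD //.
    have [/b1 //|Bx] := pselect (B1 x).
    by rewrite dp0 // mulr0 normr0 mulr_ge0 // ?(le_trans _ (dphiK 0)) // addr_ge0 // mulr_ge0.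
  - exact: measurable_funD.
  - by move=> x /p0 ->; rewrite mulr0.
  - by move=> x Bx; rewrite dp0 // p0 // !mulr0 addr0.
have f1 : (\int[@leb2 R]_(x in @B1 R) (f x * pd i phi x)%:E)%E \is a fin_num.
  by apply: (integrable_fin_num _ i1); exact: measurable_B1.
have f2 : (\int[@leb2 R]_(x in @B1 R) (pd i f x * phi x)%:E)%E \is a fin_num.
  by apply: (integrable_fin_num _ i2); exact: measurable_B1.
move: S; rewrite /= in f1 f2 *; rewrite -(fineK f1) -(fineK f2) -EFinD => -[S].
by rewrite -EFinN; congr EFin; apply/eqP; rewrite -subr_eq0 opprK S.
Unshelve. all: by end_near. Qed.

End Sobolev.

(** * One-dimensional calculus *)

Section DerivativeRules.
Context {R : realType}.
Implicit Types (f g : R -> R) (x a b : R).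

(* Not a class, unlike [is_derive]: instance resolution must not fill in derivatives. *)
Definition der1 f x a : Prop := is_derive x (1 : R) f a.

Lemma der1_eq f x a b : der1 f x a -> a = b -> der1 f x b.
Proof. by move=> ? <-. Qed.

Lemma der1_addr f g x a b : der1 f x a -> der1 g x b ->
  der1 (fun t => f t + g t) x (a + b).
Proof. exact: is_deriveD. Qed.

Lemma der1_oppr f x a : der1 f x a ->
  der1 (fun t => - f t) x (- a).
Proof. exact: is_deriveN. Qed.

Lemma der1_mulr f g x a b : der1 f x a -> der1 g x b ->
  der1 (fun t => f t * g t) x (a * g x + f x * b).
Proof.
move=> fa gb; apply: (is_derive_eq (is_deriveM fa gb)).
by rewrite /GRing.scale /= addrC mulrC.
Qed.

Lemma der1_expr f n x a : der1 f x a ->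
  der1 (fun t => f t ^+ n.+1) x (n.+1%:R * f x ^+ n * a).
Proof.
move=> fa; have -> : (fun t => f t ^+ n.+1) = f ^+ n.+1 by rewrite exprfctE.
by apply: (is_derive_eq (is_deriveX n.+1 fa)).
Qed.

Lemma der1_comp f g x a b : der1 f (g x) a -> der1 g x b ->
  der1 (fun t => f (g t)) x (a * b).
Proof. exact: is_derive1_comp. Qed.

Lemma der1_invr f x a : f x != 0 -> der1 f x a ->
  der1 (fun t => (f t)^-1) x (- a / f x ^+ 2).
Proof.
move=> fx [df <-]; split; first exact: derivableV.
rewrite deriveV // /GRing.scale /= mulrC mulNr mulrN exprnN //.
Qed.

Lemma der1_const (c x : R) : der1 (fun=> c) x 0.
Proof. exact: is_derive_cst. Qed.

Lemma der1_var (x : R) : der1 (fun t => t) x 1.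
Proof. exact: is_derive_id. Qed.

Lemma der1_near f g x a : (\forall t \near x, f t = g t) ->
  der1 g x a -> der1 f x a.
Proof.
move=> fg; apply: near_eq_is_derive.
by near=> t; apply/esym; near: t.
Unshelve. all: by end_near. Qed.

(** The first-order remainder of [f] is controlled by that of [g]. For functions glued along a
    common tangent at [x] this replaces a discussion of one-sided derivatives. *)
Lemma der1_dominated f g x a : der1 g x a ->
  (\forall t \near x, `|f t - f x - a * (t - x)| <= `|g t - g x - a * (t - x)|) ->
  der1 f x a.
Proof.
move=> [dg <-] H.
suff L : h^-1 *: ((f \o shift x) (h *: (1 : R)) - f x) @[h --> 0^'] --> 'D_1 g x.
  by split; [apply/cvg_ex; exists ('D_1 g x)|exact/cvg_lim].
have G : h^-1 *: ((g \o shift x) (h *: (1 : R)) - g x) @[h --> 0^'] --> 'D_1 g x.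
  exact: dg.
apply/cvgrPdist_le => e e0; move/cvgrPdist_le : G => /(_ _ e0) G.
have H' : \forall h \near 0^', `|f (h + x) - f x - 'D_1 g x * (h + x - x)| <=
    `|g (h + x) - g x - 'D_1 g x * (h + x - x)|.
  apply: nbhs_dnbhs; have := H; rewrite (near_shift 0) /=.
  by apply: filterS => h; rewrite subr0 .
near=> h.
have h0 : h != 0 by near: h; exact: nbhs_dnbhs_neq.
have : `|'D_1 g x - h^-1 *: ((g \o shift x) (h *: (1 : R)) - g x)| <= e by near: h.
apply: le_trans.
have E (k : R -> R) : `|'D_1 g x - h^-1 *: ((k \o shift x) (h *: (1 : R)) - k x)| =
    `|h|^-1 * `|k (h + x) - k x - 'D_1 g x * (h + x - x)|.
  rewrite -normfV -normrM -normrN; congr (`| _ |).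
  rewrite /GRing.scale /= mulr1; field. exact: h0.
rewrite !E ler_wpM2l ?invr_ge0 //.
by near: h.
Unshelve. all: by end_near. Qed.

End DerivativeRules.

(** Differentiation guided by the syntax: the derivative is built in an existential variable, while
    derivatives of named functions and nonvanishing denominators are left as goals. *)
Ltac der := cbv beta; first [eapply der1_const | eapply der1_var | lazymatch goal with
  | |- der1 (fun t => @?f t + @?g t) _ _ => eapply (@der1_addr _ f g); der
  | |- der1 (fun t => - @?f t) _ _ => eapply (@der1_oppr _ f); der
  | |- der1 (fun t => @?f t * @?g t) _ _ => eapply (@der1_mulr _ f g); der
  | |- der1 (fun t => @?f t ^+ _.+1) _ _ => eapply (@der1_expr _ f); der
  | |- der1 (fun t => (@?f t)^-1) _ _ => eapply (@der1_invr _ f); [|der]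
  | |- der1 (fun t => ?f (@?g t)) _ _ => first [eapply (@der1_comp _ f g); [|der] | idtac]
  | |- _ => idtac
  end].

(** * Extension by tangents outside [[-1, 1]] *)

Section Clamp.
Context {R : realType}.

Definition cl (t : R) : R := Num.max (-1) (Num.min 1 t).

Variant cl_spec (t : R) : R -> Prop :=
  | ClIn of -1 <= t & t <= 1 : cl_spec t t
  | ClGt of 1 < t : cl_spec t 1
  | ClLt of t < -1 : cl_spec t (-1).

Lemma clP t : cl_spec t (cl t).
Proof.
rewrite /cl; case: (leP 1 t) => t1.
  move: t1; rewrite le_eqVlt => /orP[/eqP<-|t1].
    by rewrite max_r; [constructor|]; lra.
  by rewrite max_r; [constructor|lra].
case: (leP (-1) t) => t2; first by constructor; lra.
by constructor.
Qed.

Lemma cl_bound t : -1 <= cl t <= 1.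
Proof. by case: clP => *; lra. Qed.

Definition ext (g g' : R -> R) (t : R) : R := g (cl t) + g' (cl t) * (t - cl t).

(** At an endpoint the remainder of the extension is that of [g] on one side and zero on the other,
    so [der1_dominated] applies. *)
Lemma der1_ext (g g' : R -> R) (t : R) :
  (forall x : R, der1 g x (g' x)) ->
  der1 (ext g g') t (g' (cl t)).
Proof.
move=> gg'.
have E y : -1 <= y <= 1 -> ext g g' y = g y.
  by rewrite /ext; case: clP => *; try lra; ring.
case: clP => [t1 t2|t1|t1].
- apply: der1_dominated (gg' t) _.
  move: t1 t2; rewrite le_eqVlt => /predU1P[<- _|t1].
    near=> y; case: (leP (-1) y) => y1.
      have y2 : y < 1 by near: y; apply: lt_nbhsl; lra.
      by rewrite !E //; lra.
    rewrite (E (-1)); last lra.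
    rewrite (_ : _ - _ - _ = 0) ?normr0 //.
    by rewrite /ext; case: clP => *; try lra; ring.
  rewrite le_eqVlt => /predU1P[->|t2].
    near=> y; case: (leP y 1) => y1.
      have y2 : -1 < y by near: y; apply: lt_nbhsr; lra.
      by rewrite !E //; lra.
    rewrite (E 1); last lra.
    rewrite (_ : _ - _ - _ = 0) ?normr0 //.
    by rewrite /ext; case: clP => *; try lra; ring.
  near=> y; rewrite !E //; first lra.
  by apply/andP; split; apply: ltW; near: y; [exact: lt_nbhsr|exact: lt_nbhsl].
- apply: (@der1_near _ _ (fun y => g 1 + g' 1 * (y - 1))).
    near=> y; have y1 : 1 < y by near: y; exact: lt_nbhsr.
    by rewrite /ext; case: clP => *; try lra.
  apply: der1_eq; [der|rewrite /=; ring].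
- apply: (@der1_near _ _ (fun y => g (-1) + g' (-1) * (y - (-1)))).
    near=> y; have y1 : y < -1 by near: y; exact: lt_nbhsl.
    by rewrite /ext; case: clP => *; try lra.
  apply: der1_eq; [der|rewrite /=; ring].
Unshelve. all: by end_near. Qed.
End Clamp.

(** * The profile of the lens and the cutoff *)

Section Profile.
Context {R : realType}.
Implicit Types (c t : R).

(* [F0 - 8 |c|] vanishes to third order at [c = 1] and [c = -1], so that [f0] below
   is the C^2 extension of [F0] by [8 |t|].  [I0] is a primitive of [F1 ^+ 2] and
   [Q0 - c Q0'] is half the square of [F0 - c F1]: these two solve the strain
   equations of the lens. *)
Definition F0 c : R := 3 + 6 * c ^+ 2 - c ^+ 4.
Definition F1 c : R := 12 * c - 4 * c ^+ 3.
Definition F2 c : R := 12 - 12 * c ^+ 2.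
Definition I0 c : R := 16 * (3 * c ^+ 3 - 6 / 5 * c ^+ 5 + 1 / 7 * c ^+ 7).
Definition Q0 c : R :=
  9 / 2 * (1 + 4 * c ^+ 2 - 2 * c ^+ 4 + 4 / 5 * c ^+ 6 - 1 / 7 * c ^+ 8).
Definition Q1 c : R := 36 * (c - c ^+ 3 + 3 / 5 * c ^+ 5 - 1 / 7 * c ^+ 7).

Lemma der1_F0 c : der1 F0 c (F1 c).
Proof. by apply: der1_eq; [rewrite /F0; der|rewrite /F1 /=; field]. Qed.

Lemma der1_F1 c : der1 F1 c (F2 c).
Proof. by apply: der1_eq; [rewrite /F1; der|rewrite /F2 /=; field]. Qed.

Lemma der1_I0 c : der1 I0 c (F1 c ^+ 2).
Proof. by apply: der1_eq; [rewrite /I0; der|rewrite /F1 /=; field]. Qed.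

Lemma der1_Q0 c : der1 Q0 c (Q1 c).
Proof. by apply: der1_eq; [rewrite /Q0; der|rewrite /Q1 /=; field]. Qed.

(** The intercept of a tangent is constant along it, so only the clamped argument matters. This
    intercept is the [v]-derivative of [v g(t)] for [t = m u / v]. *)
Lemma ext_legendre (g g' : R -> R) t :
  ext g g' t - t * g' (cl t) = g (cl t) - cl t * g' (cl t).
Proof. by rewrite /ext; ring. Qed.

(** With vanishing slopes at both ends the tangents are horizontal, and clamping the argument is the
    same as [ext]. *)
Lemma der1_clamp (g g' : R -> R) t : (forall c, der1 g c (g' c)) ->
  g' 1 = 0 -> g' (-1) = 0 -> der1 (fun u => g (cl u)) t (g' (cl t)).
Proof.
move=> gg' g1 gN1.
have -> : (fun u => g (cl u)) = ext g g'; last exact: der1_ext.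
by apply/funext => u; rewrite /ext; case: clP => *; rewrite ?g1 ?gN1; ring.
Qed.

Definition f0 : R -> R := ext F0 F1.
Definition f1 t : R := F1 (cl t).
Definition f2 t : R := F2 (cl t).
Definition fI : R -> R := ext I0 (fun c => F1 c ^+ 2).
Definition fQ : R -> R := ext Q0 Q1.
(* The Legendre-type combination giving the [x_2]-derivative of [x_2 f0 (x_1 / x_2)]. *)
Definition leg t : R := F0 (cl t) - cl t * F1 (cl t).

Lemma der1_f0 t : der1 f0 t (f1 t).
Proof. by apply: der1_ext; exact: der1_F0. Qed.

Lemma der1_f1 t : der1 f1 t (f2 t).
Proof. by apply: (der1_clamp F1 F2); [exact: der1_F1|rewrite /F2; ring..]. Qed.

Lemma der1_fI t : der1 fI t (f1 t ^+ 2).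
Proof. by apply: (@der1_ext _ I0 (fun c => F1 c ^+ 2)); exact: der1_I0. Qed.

Lemma der1_fQ t : der1 fQ t (Q1 (cl t)).
Proof. by apply: der1_ext; exact: der1_Q0. Qed.

Lemma der1_leg t : der1 leg t (- (cl t * f2 t)).
Proof.
apply: (der1_clamp (fun c => F0 c - c * F1 c) (fun c => - (c * F2 c))).
- move=> c; apply: der1_eq; first by der; [exact: der1_F0|exact: der1_F1].
  by rewrite /=; ring.
- by rewrite /F2; ring.
- by rewrite /F2; ring.
Qed.

Lemma f0_ge t : 8 * `|t| <= f0 t.
Proof.
rewrite /f0 /ext /F0 /F1; case: clP => [t1 t2|t1|t1].
- rewrite subrr mulr0 addr0 -subr_ge0.
  have -> : 3 + 6 * t ^+ 2 - t ^+ 4 - 8 * `|t| = (1 - `|t|) ^+ 3 * (3 + `|t|).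
    have : t ^+ 2 = `|t| ^+ 2 by rewrite real_normK ?num_real.
    rewrite (_ : t ^+ 4 = (t ^+ 2) ^+ 2); last by ring.
    by move=> ->; ring.
  have n1 : `|t| <= 1 by rewrite ler_norml t1.
  by apply: mulr_ge0; [apply: exprn_ge0; lra|have := normr_ge0 t; lra].
- rewrite gtr0_norm; lra.
- rewrite ltr0_norm; lra.
Qed.

Lemma f0_ge3 t : 3 <= f0 t.
Proof.
rewrite /f0 /ext /F0 /F1; case: clP => [t1 t2|t1|t1]; [|lra..].
have : 0 <= t ^+ 2 * (6 - t ^+ 2).
  by apply: mulr_ge0; [exact: sqr_ge0|nra].
rewrite (_ : t ^+ 4 = t ^+ 2 * t ^+ 2); last by ring.
lra.
Qed.

Lemma f0_le8 t : `|t| <= 1 -> f0 t <= 8.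
Proof.
rewrite ler_norml => /andP[? ?].
rewrite /f0 /ext /F0 /F1; case: clP => [t1 t2|t1|t1]; [|lra..].
have : 0 <= (1 - t ^+ 2) * (5 - t ^+ 2).
  have : t ^+ 2 <= 1 by nra.
  by move=> ?; rewrite mulr_ge0; lra.
rewrite (_ : t ^+ 4 = t ^+ 2 * t ^+ 2); last by ring.
lra.
Qed.

Lemma f0_le t : f0 t <= 8 * `|t| + 8.
Proof.
case: (leP `|t| 1) => [/f0_le8|]; first by have := normr_ge0 t; lra.
rewrite /f0 /ext /F0 /F1; case: clP => [t1 t2|t1|t1].
- by rewrite ltNge ler_norml t1 t2.
- by move=> _; rewrite gtr0_norm; lra.
- by move=> _; rewrite ltr0_norm; lra.
Qed.

Lemma f0_out t : 1 <= `|t| -> f0 t = 8 * `|t|.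
Proof.
rewrite /f0 /ext /F0 /F1; case: clP => [t1 t2|t1|t1].
- rewrite ler_normr => /orP[] t3.
    have -> : t = 1 by lra.
    by rewrite normr1; ring.
  have -> : t = -1 by lra.
  by rewrite normrN1; ring.
- by rewrite gtr0_norm; lra.
- by rewrite ltr0_norm; lra.
Qed.

Lemma cl_sg t : 1 <= `|t| -> cl t = Num.sg t.
Proof.
case: clP => [t1 t2|t1|t1].
- rewrite ler_normr => /orP[] t3.
    have -> : t = 1 by lra.
    by rewrite sgr1.
  have -> : t = -1 by lra.
  by rewrite sgrN1.
- by rewrite gtr0_sg; lra.
- by rewrite ltr0_sg; lra.
Qed.

(** A C^2 version of the positive part: as [f0 t = 8 |t|] for [|t| >= 1], it is [0] up to [-1] and
    [t] from [1] on. *)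
Definition s0 t : R := f0 t / 16 + t / 2.
Definition s1 t : R := f1 t / 16 + 1 / 2.
Definition s2 t : R := f2 t / 16.

Lemma der1_s0 t : der1 s0 t (s1 t).
Proof.
apply: der1_eq; first by rewrite /s0; der; exact: der1_f0.
by rewrite /s1 /=; field.
Qed.

Lemma der1_s1 t : der1 s1 t (s2 t).
Proof.
apply: der1_eq; first by rewrite /s1; der; exact: der1_f1.
by rewrite /s2 /=; field.
Qed.

Lemma s0_bounds t : Num.max 0 t <= s0 t <= Num.max 0 t + 1.
Proof.
rewrite /s0; have := f0_ge t; have := f0_le t.
case: (leP 0 t) => t0; last by rewrite (ltr0_norm t0); lra.
by rewrite (ger0_norm t0); lra.
Qed.

Lemma s0_low t : t <= -1 -> s0 t = 0.
Proof.
move=> t1; rewrite /s0 f0_out; first by rewrite ltr0_norm; lra.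
by rewrite ltr0_norm; lra.
Qed.

Lemma s1_bounds t : 0 <= s1 t <= 1.
Proof.
rewrite /s1 /f1 /F1; have := cl_bound t; set c := cl t => /andP[c1 c2].
have H1 : 0 <= (1 + c) ^+ 2 * (2 - c) by rewrite mulr_ge0 ?sqr_ge0; lra.
have H2 : 0 <= (1 - c) ^+ 2 * (2 + c) by rewrite mulr_ge0 ?sqr_ge0; lra.
move: H1 H2.
have -> : (1 + c) ^+ 2 * (2 - c) = 2 + 3 * c - c ^+ 3 by ring.
have -> : (1 - c) ^+ 2 * (2 + c) = 2 - 3 * c + c ^+ 3 by ring.
lra.
Qed.

Lemma s1_low t : t <= -1 -> s1 t = 0.
Proof.
move=> t1; rewrite /s1 /f1 /F1 cl_sg; last by rewrite ltr0_norm; lra.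
by rewrite ltr0_sg; lra.
Qed.

Lemma s1_high t : 1 <= t -> s1 t = 1.
Proof.
move=> t1; rewrite /s1 /f1 /F1 cl_sg; last by rewrite gtr0_norm; lra.
by rewrite gtr0_sg; lra.
Qed.

Lemma f2_out t : 1 <= `|t| -> f2 t = 0.
Proof.
move=> t1; rewrite /f2 /F2 cl_sg // sqr_sg.
have -> : t != 0 by rewrite -normr_gt0; lra.
by rewrite mulr1 subrr.
Qed.

Lemma f2_bounds t : 0 <= f2 t <= 12.
Proof.
rewrite /f2 /F2; have := cl_bound t; set c := cl t => /andP[c1 c2].
have := sqr_ge0 c; have : c ^+ 2 <= 1 by nra.
lra.
Qed.

Section Cutoff.
Variables (e d : R).
Hypotheses (e0 : 0 < e) (d0 : 0 < d).

(* [Phi0] is [0] on [[0, e]], has slope [1] on [[3 e, d]] and slope [0] beyond [3 d]: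
   the lower transition removes the tip, the upper one flattens the sheet. *)
Definition Phi0 t : R := e * s0 (t / e - 2) - d * s0 (t / d - 2).
Definition Phi1 t : R := s1 (t / e - 2) - s1 (t / d - 2).
Definition Phi2 t : R := s2 (t / e - 2) / e - s2 (t / d - 2) / d.

Lemma der1_Phi0 t : der1 Phi0 t (Phi1 t).
Proof.
apply: der1_eq; first by rewrite /Phi0; der; [exact: der1_s0|exact: der1_s0].
by rewrite /Phi1 /=; field; rewrite !lt0r_neq0.
Qed.

Lemma der1_Phi1 t : der1 Phi1 t (Phi2 t).
Proof.
apply: der1_eq; first by rewrite /Phi1; der; [exact: der1_s1|exact: der1_s1].
by rewrite /Phi2 /=; field; rewrite !lt0r_neq0.
Qed.

Lemma Phi1_bound t : `|Phi1 t| <= 1.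
Proof.
rewrite /Phi1; have := s1_bounds (t / e - 2); have := s1_bounds (t / d - 2).
by rewrite ler_norml; lra.
Qed.

(** [s2 (t / r - 2)] lives on [r < t < 3 r], where [t / r] is at most [3]; with [f2 <= 12] this
    gives [12 / 16 * 3 <= 3] at every scale [r]. *)
Lemma s2_scaled (r t : R) : 0 < r -> 0 <= t -> 0 <= s2 (t / r - 2) / r * t <= 3.
Proof.
move=> r0 t0; have -> : s2 (t / r - 2) / r * t = s2 (t / r - 2) * (t / r) by ring.
have u0 : 0 <= t / r by rewrite divr_ge0 // ltW.
move: (t / r) u0 => u u0; rewrite /s2; have := f2_bounds (u - 2).
case: (leP 1 `|u - 2|) => [/f2_out -> _|]; first by rewrite !mul0r; lra.
rewrite ltr_norml => /andP[u1 u2]; set y := f2 _ => /andP[y0 y1].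
rewrite mulr_ge0 //=; last by lra.
by rewrite (@le_trans _ _ (12 / 16 * 3)) ?ler_pM //; lra.
Qed.

Lemma Phi2_bound t : 0 <= t -> `|Phi2 t * t| <= 3.
Proof.
move=> t0; rewrite /Phi2 mulrBl.
have := s2_scaled _ _ e0 t0; have := s2_scaled _ _ d0 t0.
by rewrite ler_norml; lra.
Qed.

Lemma Phi_low t : t <= e -> t <= d -> [/\ Phi0 t = 0, Phi1 t = 0 & Phi2 t = 0].
Proof.
move=> te td.
have L r : 0 < r -> t <= r -> t / r - 2 <= -1.
  by move=> r0 tr; have : t / r <= 1 by [rewrite ler_pdivrMr // mul1r]; lra.
have a1 := L _ e0 te; have a2 := L _ d0 td.
rewrite /Phi0 /Phi1 /Phi2 /s2 !s0_low // !s1_low // !f2_out.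
- by split; ring.
- by rewrite ltr0_norm; lra.
- by rewrite ltr0_norm; lra.
Qed.

Lemma Phi0_bound t : 0 <= t -> - 2 * e - d <= Phi0 t <= 2 * d + e.
Proof.
move=> t0; rewrite /Phi0.
have B r : 0 < r ->
    Num.max 0 (t - 2 * r) <= r * s0 (t / r - 2) <= Num.max 0 (t - 2 * r) + r.
  move=> r0; have /andP[h1 h2] := s0_bounds (t / r - 2).
  have <- : r * Num.max 0 (t / r - 2) = Num.max 0 (t - 2 * r).
    rewrite maxr_pMr ?ltW // mulr0; congr Num.max.
    by field; rewrite lt0r_neq0.
  rewrite ler_pM2l // h1 /=.
  by have := ler_wpM2l (ltW r0) h2; rewrite (mulrDr r (Num.max _ _)) mulr1.
have /andP[] := B _ e0; have /andP[] := B _ d0.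
by case: (leP 0 (t - 2 * e)) => ?; case: (leP 0 (t - 2 * d)) => ?; lra.
Qed.

End Cutoff.

(** A primitive of the squared slope lost in the upper transition, where [Phi1] has the form
    [1 - s1]; [fI] integrates the square of [f1]. *)
Definition fK t : R := 3 / 4 * t + f0 t / 16 - fI t / 256.

Lemma der1_fK t : der1 fK t (1 - (1 - s1 t) ^+ 2).
Proof.
apply: der1_eq; first by rewrite /fK; der; [exact: der1_f0|exact: der1_fI].
by rewrite /s1 /=; field.
Qed.

Lemma atan_bound t : `|atan t| <= pi / 2.
Proof. by rewrite ler_norml !ltW // ?atan_ltpi2 // -mulNr ?mulNr atan_gtNpi2. Qed.

Lemma atanV t : 0 < t -> atan t^-1 = pi / 2 - atan t.
Proof.
move=> t0; have a0 : 0 < atan t by rewrite -atan0 lt_atan.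
have a1 := atan_ltpi2 t.
rewrite -[in LHS](atanK t) -[RHS]tanK; last by rewrite in_itv /=; lra.
congr atan; rewrite /tan sinB cosB sin_pihalf cos_pihalf !mul0r !mul1r subr0 add0r.
by rewrite invf_div.
Qed.

End Profile.

(** * The support function of the lens *)

Section Lens.
Context {R : realType}.
Variables (b m : R).
Hypotheses (b_gt0 : 0 < b) (m_ge1 : 1 <= m).
Implicit Types (u v t : R).

(* [b |v| f0 (m u / v)], whose limit at [v = 0] has to be given separately as
   [u / 0 = 0].  The functions [lens_x], [lens_y] and [lens_xx], [lens_xy], [lens_yy]
   are its first and second partial derivatives away from the origin. *)
Definition lens u v : R :=
  if v == 0 then 8 * b * m * `|u| else b * `|v| * f0 (m * (u / v)).
Definition lens_x u v : R :=
  if v == 0 then 8 * b * m * Num.sg u else b * m * Num.sg v * f1 (m * (u / v)).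
Definition lens_y u v : R := if v == 0 then 0 else b * Num.sg v * leg (m * (u / v)).
Definition lens_xx u v : R :=
  if v == 0 then 0 else b * m ^+ 2 / `|v| * f2 (m * (u / v)).
Definition lens_xy u v : R := if v == 0 then 0 else
  - (b * m / `|v| * (cl (m * (u / v)) * f2 (m * (u / v)))).
Definition lens_yy u v : R := if v == 0 then 0 else
  b / `|v| * (cl (m * (u / v)) ^+ 2 * f2 (m * (u / v))).

Let m_gt0 : 0 < m. Proof. exact: lt_le_trans m_ge1. Qed.

Lemma near_sg u : u != 0 -> \forall t \near u, Num.sg t = Num.sg u.
Proof.
rewrite neq_lt => /orP[u0|u0].
  near=> t; rewrite !ltr0_sg //; near: t; exact: lt_nbhsl.
near=> t; rewrite !gtr0_sg //; near: t; exact: lt_nbhsr.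
Unshelve. all: by end_near. Qed.

Lemma near_neq0 u : u != 0 -> \forall t \near u, t != 0.
Proof.
move=> u0; apply: filterS (near_sg _ u0) => t tu.
by rewrite -sgr_eq0 tu sgr_eq0.
Qed.

(** The [x_1] axis without the origin lies inside the sectors where the clamp saturates. The
    derivatives in [v] at [v = 0] rest on this: next to the axis the quotient formulas take their
    explicit outer form. *)
Lemma near_slope u : u != 0 ->
  \forall t \near 0, t != 0 -> 1 <= `|m * (u / t)|.
Proof.
move=> u0; have u1 : 0 < `|u| by rewrite normr_gt0.
near=> t => t0; rewrite normrM (gtr0_norm m_gt0) normf_div.
have tu : `|t| <= `|u|.
  rewrite -normrN -sub0r; near: t.
  by apply: (@cvgr_dist_le _ _ _ _ _ id) => //; exact: cvg_id.
have : 1 <= `|u| / `|t| by rewrite ler_pdivlMr ?mul1r // normr_gt0.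
by move=> H; rewrite (le_trans H) // ler_peMl // (le_trans _ H).
Unshelve. all: by end_near. Qed.

Lemma div_sg v : v != 0 -> `|v| / v = Num.sg v.
Proof. by move=> v0; rewrite [`|v|]normrEsg mulfK. Qed.

Lemma sg_div v : v != 0 -> Num.sg v / v = `|v|^-1.
Proof.
move=> v0; rewrite [in RHS]normrEsg invfM; congr (_ * _).
by move: v0; case: sgrP => // _ _; rewrite ?invr1 // invrN1.
Qed.

(** [f2] vanishes where the clamp acts, so the unbounded factor [t] can be traded for a bounded
    one. *)
Lemma cl_f2 t : t * f2 t = cl t * f2 t.
Proof.
case: (leP 1 `|t|) => [/f2_out ->|]; first by rewrite !mulr0.
by rewrite ltr_norml; case: clP => *; lra.
Qed.

Lemma dx_lens u v : (v != 0) || (u != 0) -> der1 (lens^~ v) u (lens_x u v).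
Proof.
rewrite /lens /lens_x; case: eqVneq => [_ /= u0|v0 _].
  apply: (@der1_near _ _ (fun t => 8 * b * m * (Num.sg u * t))).
    by apply: filterS (near_sg _ u0) => t tu; rewrite normrEsg tu.
  by apply: der1_eq; [der|rewrite /=; ring].
apply: der1_eq; first by der; exact: der1_f0.
by rewrite /= -div_sg //; field.
Qed.

Lemma dy_lens u v : (v != 0) || (u != 0) -> der1 (lens u) v (lens_y u v).
Proof.
have [-> /= u0|v0 _] := eqVneq v 0.
  apply: (@der1_near _ _ (fun=> 8 * b * m * `|u|)); last first.
    by rewrite /lens_y eqxx; exact: der1_const.
  apply: filterS (near_slope _ u0) => t; rewrite /lens; case: eqVneq => // t0 /(_ isT) h.
  rewrite f0_out // !normrM (gtr0_norm m_gt0) normfV; field.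
  by rewrite normr_eq0.
apply: (@der1_near _ _ (fun t => b * (Num.sg v * t) * f0 (m * (u / t)))).
  apply: filterS2 (near_sg _ v0) (near_neq0 _ v0) => t tv t0.
  by rewrite /lens (negbTE t0) normrEsg tv.
apply: der1_eq; first by der; [exact: der1_f0|exact: v0].
rewrite /lens_y (negbTE v0) /leg -ext_legendre -/(f0 _) -/(f1 _) /=; field.
exact: v0.
Qed.

Lemma dx_lens_x u v : (v != 0) || (u != 0) -> der1 (lens_x^~ v) u (lens_xx u v).
Proof.
rewrite /lens_x /lens_xx; case: eqVneq => [_ /= u0|v0 _].
  apply: (@der1_near _ _ (fun=> 8 * b * m * Num.sg u)); last exact: der1_const.
  by apply: filterS (near_sg _ u0) => t ->.
apply: der1_eq; first by der; exact: der1_f1.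
by rewrite /= -sg_div //; field.
Qed.

Lemma dy_lens_x u v : (v != 0) || (u != 0) -> der1 (lens_x u) v (lens_xy u v).
Proof.
have [-> /= u0|v0 _] := eqVneq v 0.
  apply: (@der1_near _ _ (fun=> 8 * b * m * Num.sg u)); last first.
    by rewrite /lens_xy eqxx; exact: der1_const.
  apply: filterS (near_slope _ u0) => t; rewrite /lens_x; case: eqVneq => // t0 /(_ isT) h.
  rewrite /f1 cl_sg // !sgrM (gtr0_sg m_gt0) sgrV /F1.
  have : Num.sg t ^+ 2 = 1 by rewrite sqr_sg t0.
  have : Num.sg u ^+ 2 = 1 by rewrite sqr_sg u0.
  move: (Num.sg u) (Num.sg t) => su st su2 st2.
  rewrite mul1r; rewrite (_ : _ ^+ 3 = su * st * (su ^+ 2 * st ^+ 2)); last by ring.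
  rewrite su2 st2 (_ : 12 * _ - _ = 8 * (su * st)); last by ring.
  rewrite (_ : _ * st * _ = 8 * b * m * su * st ^+ 2); last by ring.
  by rewrite st2 mulr1.
apply: (@der1_near _ _ (fun t => b * m * Num.sg v * f1 (m * (u / t)))).
  apply: filterS2 (near_sg _ v0) (near_neq0 _ v0) => t tv t0.
  by rewrite /lens_x (negbTE t0) tv.
apply: der1_eq; first by der; [exact: der1_f1|exact: v0].
rewrite /lens_xy (negbTE v0) -cl_f2 -sg_div //=; field.
exact: v0.
Qed.

Lemma leg_out t : 1 <= `|t| -> leg t = 0.
Proof.
move=> t1; rewrite /leg /F0 /F1 cl_sg //.
have t0 : t != 0 by rewrite -normr_gt0; lra.
have : Num.sg t ^+ 2 = 1 by rewrite sqr_sg t0.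
move: (Num.sg t) => s s2.
rewrite (_ : _ - _ = 3 * (1 - s ^+ 2) ^+ 2); last by ring.
by rewrite s2; ring.
Qed.

Lemma dx_lens_y u v : (v != 0) || (u != 0) -> der1 (lens_y^~ v) u (lens_xy u v).
Proof.
rewrite /lens_y /lens_xy; case: eqVneq => [_ /= u0|v0 _]; first exact: der1_const.
apply: der1_eq; first by der; exact: der1_leg.
by rewrite /= -sg_div //; field.
Qed.

Lemma dy_lens_y u v : (v != 0) || (u != 0) -> der1 (lens_y u) v (lens_yy u v).
Proof.
have [-> /= u0|v0 _] := eqVneq v 0.
  apply: (@der1_near _ _ (fun=> 0)); last first.
    by rewrite /lens_yy eqxx; exact: der1_const.
  apply: filterS (near_slope _ u0) => t; rewrite /lens_y; case: eqVneq => // t0 /(_ isT) h.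
  by rewrite leg_out // mulr0.
apply: (@der1_near _ _ (fun t => b * Num.sg v * leg (m * (u / t)))).
  apply: filterS2 (near_sg _ v0) (near_neq0 _ v0) => t tv t0.
  by rewrite /lens_y (negbTE t0) tv.
apply: der1_eq; first by der; [exact: der1_leg|exact: v0].
rewrite /lens_yy (negbTE v0).
have -> : cl (m * (u / v)) ^+ 2 * f2 (m * (u / v)) =
    cl (m * (u / v)) * (m * (u / v) * f2 (m * (u / v))) by rewrite cl_f2; ring.
by rewrite -sg_div //=; field; exact: v0.
Qed.

Lemma lens_ge0 u v : 0 <= lens u v.
Proof.
rewrite /lens; case: eqVneq => _; first by rewrite !mulr_ge0 // ltW.
by rewrite !mulr_ge0 // ?ltW //; have := f0_ge3 (m * (u / v)); lra.
Qed.

Lemma lens_gex u v : 8 * b * m * `|u| <= lens u v.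
Proof.
rewrite /lens; case: eqVneq => // v0.
have -> : 8 * b * m * `|u| = b * `|v| * (8 * `|m * (u / v)|).
  rewrite !normrM normfV (gtr0_norm m_gt0); field.
  by rewrite normr_eq0.
by rewrite ler_wpM2l ?f0_ge // mulr_ge0 // ltW.
Qed.

Lemma lens_gey u v : 3 * b * `|v| <= lens u v.
Proof.
rewrite /lens; case: eqVneq => [->|v0].
  by rewrite normr0 mulr0 !mulr_ge0 // ltW.
rewrite (_ : 3 * b * `|v| = b * `|v| * 3); last by ring.
by rewrite ler_wpM2l ?f0_ge3 // mulr_ge0 // ltW.
Qed.

(** Turns bounds in terms of the lens into decay in [|x|]. *)
Lemma lens_ge u v : 3 * b * Num.max `|u| `|v| <= lens u v.
Proof.
have b3 : 0 <= 3 * b by have := b_gt0; lra.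
rewrite maxr_pMr // ge_max lens_gey andbT (le_trans _ (lens_gex u v)) //.
rewrite ler_wpM2r //.
have : b * 1 <= b * m by rewrite ler_pM2l.
by have := b_gt0; lra.
Qed.

Lemma lens_x_bound u v : `|lens_x u v| <= 8 * b * m.
Proof.
have bm : 0 < b * m by rewrite mulr_gt0.
have sg1 (t : R) : `|Num.sg t| <= 1.
  by case: sgrP => _; rewrite ?normr0 ?normrN1 ?normr1 // ler01.
rewrite /lens_x; case: eqVneq => _.
  by rewrite normrM gtr0_norm; [rewrite ler_piMr //|]; lra.
rewrite !normrM -[`|b| * _]normrM (gtr0_norm bm).
have f18 : `|f1 (m * (u / v))| <= 8.
  by have := s1_bounds (m * (u / v)); rewrite /s1 ler_norml; lra.
have -> : 8 * b * m = b * m * 1 * 8 by ring.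
by rewrite ler_pM ?mulr_ge0 // ?ler_wpM2l // ltW.
Qed.

Lemma lens_y_bound u v : `|lens_y u v| <= 8 * b * m.
Proof.
have bm : b * 1 <= b * m by rewrite ler_pM2l.
have sg1 (t : R) : `|Num.sg t| <= 1.
  by case: sgrP => _; rewrite ?normr0 ?normrN1 ?normr1 // ler01.
rewrite /lens_y; case: eqVneq => _; first by rewrite normr0; have := b_gt0; lra.
rewrite !normrM (gtr0_norm b_gt0).
have leg3 : `|leg (m * (u / v))| <= 8.
  rewrite /leg /F0 /F1; have := cl_bound (m * (u / v)).
  set c := cl _ => /andP[c1 c2]; have c3 : 0 <= c ^+ 2 <= 1 by rewrite sqr_ge0; nra.
  rewrite (_ : _ - _ = 3 * (1 - c ^+ 2) ^+ 2); last by ring.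
  by rewrite ger0_norm; [nra|rewrite mulr_ge0 ?sqr_ge0].
have le : b * `|Num.sg v| * `|leg (m * (u / v))| <= b * 1 * 8.
  by rewrite ler_pM ?mulr_ge0 // ?ler_wpM2l // ltW.
by rewrite (le_trans le) //; lra.
Qed.

Lemma f0f2_bound t : 0 <= f0 t * f2 t <= 96.
Proof.
have /andP[f20 f21] := f2_bounds t; have f00 := f0_ge3 t.
rewrite mulr_ge0 //=; last by lra.
case: (leP 1 `|t|) => [/f2_out ->|/ltW/f0_le8 h]; first by rewrite mulr0.
by have := ler_pM (le_trans (ler0n _ 3) f00) f20 h f21; lra.
Qed.

(** A second derivative times the lens is 0-homogeneous, hence a function of the slope. It is
    bounded because [f2] is nonzero only for [|t| < 1], where [f0 <= 8]; whence [8 * 12 = 96]. The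
    factors [k] and [c] serve all entries of the Hessian at once. *)
Lemma hess_bound u v (k c : R) : 0 <= k -> k <= m ^+ 2 -> `|c| <= 1 -> v != 0 ->
  `|b * k / `|v| * (c * f2 (m * (u / v)))| * lens u v <= 96 * (b * m) ^+ 2.
Proof.
move=> k0 km c1 v0; rewrite /lens (negbTE v0).
have /andP[h0 h1] := f0f2_bound (m * (u / v)).
have /andP[f20 _] := f2_bounds (m * (u / v)).
have v1 : 0 < `|v| by rewrite normr_gt0.
rewrite !normrM normfV normr_id (gtr0_norm b_gt0) (ger0_norm k0) (ger0_norm f20).
set y := f2 _ in h0 h1 *; set z := f0 _ in h0 h1 *.
have -> : b * k / `|v| * (`|c| * y) * (b * `|v| * z) = b ^+ 2 * (k * (`|c| * (z * y))).
  by field; rewrite gt_eqF.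
have -> : 96 * (b * m) ^+ 2 = b ^+ 2 * (m ^+ 2 * (1 * 96)) by ring.
apply: ler_wpM2l; first exact: sqr_ge0.
apply: ler_pM => //; first by rewrite mulr_ge0.
by apply: ler_pM.
Qed.

Lemma lens_xx_bound u v : `|lens_xx u v| * lens u v <= 96 * (b * m) ^+ 2.
Proof.
rewrite /lens_xx; case: eqVneq => [_|v0].
  by rewrite normr0 mul0r mulr_ge0 ?sqr_ge0.
by have := @hess_bound u v (m ^+ 2) 1; rewrite mul1r; apply; rewrite ?sqr_ge0 ?normr1.
Qed.

Lemma cl_norm t : `|cl t| <= 1.
Proof. by rewrite ler_norml cl_bound. Qed.

Lemma lens_xy_bound u v : `|lens_xy u v| * lens u v <= 96 * (b * m) ^+ 2.
Proof.
rewrite /lens_xy; case: eqVneq => [_|v0].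
  by rewrite normr0 mul0r mulr_ge0 ?sqr_ge0.
rewrite normrN; apply: hess_bound => //; [exact: ltW| |exact: cl_norm].
by rewrite expr2 ler_peMr // ltW.
Qed.

Lemma lens_yy_bound u v : `|lens_yy u v| * lens u v <= 96 * (b * m) ^+ 2.
Proof.
rewrite /lens_yy; case: eqVneq => [_|v0].
  by rewrite normr0 mul0r mulr_ge0 ?sqr_ge0.
have := @hess_bound u v 1 (cl (m * (u / v)) ^+ 2); rewrite mulr1; apply => //.
  exact: exprn_ege1.
by rewrite normrX expr_le1 // cl_norm.
Qed.

End Lens.

(** * The lens with its tip cut off and its ends flattened *)

Section OutOfPlane.
Context {R : realType}.
Variables (b m e : R).
Hypotheses (b_gt0 : 0 < b) (m_ge1 : 1 <= m) (e_gt0 : 0 < e) (e_le : e <= 8 * b).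
Implicit Types (u v t : R).

Local Notation wf := (lens b m).
Local Notation w1 := (lens_x b m).
Local Notation w2 := (lens_y b m).
Local Notation w11 := (lens_xx b m).
Local Notation w12 := (lens_xy b m).
Local Notation w22 := (lens_yy b m).
Local Notation Phi0 := (Phi0 e (8 * b)).
Local Notation Phi1 := (Phi1 e (8 * b)).
Local Notation Phi2 := (Phi2 e (8 * b)).

Definition capped u v : R := Phi0 (wf u v).
Definition capped_x u v : R := Phi1 (wf u v) * w1 u v.
Definition capped_y u v : R := Phi1 (wf u v) * w2 u v.
Definition capped_xx u v : R := Phi2 (wf u v) * w1 u v ^+ 2 + Phi1 (wf u v) * w11 u v.
Definition capped_xy u v : R :=
  Phi2 (wf u v) * w1 u v * w2 u v + Phi1 (wf u v) * w12 u v.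
Definition capped_yy u v : R := Phi2 (wf u v) * w2 u v ^+ 2 + Phi1 (wf u v) * w22 u v.

Let d_gt0 : 0 < 8 * b. Proof. by rewrite mulr_gt0. Qed.
Let m_gt0 : 0 < m. Proof. exact: lt_le_trans m_ge1. Qed.

(** Below level [e] neither transition has begun, the upper one because [e <= 8 b]. This removes the
    singularity of the lens at the origin. *)
Lemma capped_low u v : wf u v <= e ->
  [/\ capped u v = 0, capped_x u v = 0, capped_y u v = 0 & [/\ capped_xx u v = 0, capped_xy u v = 0 & capped_yy u v = 0]].
Proof.
move=> we; have [P0 P1 P2] := @Phi_low R e (8 * b) e_gt0 d_gt0 _ we (le_trans we e_le).
by rewrite /capped /capped_x /capped_y /capped_xx /capped_xy /capped_yy P0 P1 P2 !mul0r addr0.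
Qed.

Lemma near_scaled (k : R) : 0 < k -> \forall t \near (0 : R), k * `|t| <= e.
Proof.
move=> k0; near=> t; rewrite mulrC -ler_pdivlMr // -normrN -sub0r; near: t.
by apply: (@cvgr_dist_le _ _ _ _ _ id); [exact: cvg_id|exact: divr_gt0].
Unshelve. all: by end_near. Qed.

Lemma near_lensx : \forall t \near (0 : R), wf t 0 <= e.
Proof.
have := near_scaled (8 * b * m) (mulr_gt0 d_gt0 m_gt0).
by apply: filterS => t; rewrite /lens eqxx.
Qed.

Lemma near_lensy : \forall t \near (0 : R), wf 0 t <= e.
Proof.
have k0 : 0 < b * f0 (0 : R) by rewrite mulr_gt0 // (lt_le_trans _ (f0_ge3 _)).
apply: filterS (near_scaled _ k0) => t; rewrite /lens mul0r mulr0 normr0 mulr0.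
by case: eqVneq => [_ _|_]; [exact: ltW|rewrite mulrAC].
Qed.

Lemma lens00 : wf 0 0 = 0.
Proof. by rewrite /lens eqxx normr0 mulr0. Qed.

(** A partial derivative at the origin only sees its axis, on which the lens stays below [e] near
    the origin. *)
Lemma dx_origin (g : R -> R -> R) : (forall u v, wf u v <= e -> g u v = 0) ->
  der1 (g^~ 0) 0 0.
Proof.
move=> g0; apply: (@der1_near _ _ (fun=> 0)); last exact: der1_const.
by apply: filterS near_lensx => t /g0.
Qed.

Lemma dy_origin (g : R -> R -> R) : (forall u v, wf u v <= e -> g u v = 0) ->
  der1 (g 0) 0 0.
Proof.
move=> g0; apply: (@der1_near _ _ (fun=> 0)); last exact: der1_const.
by apply: filterS near_lensy => t /g0.
Qed.

Let W00 : wf 0 0 <= e. Proof. by rewrite lens00 ltW. Qed.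

Lemma dx_capped u v : der1 (capped^~ v) u (capped_x u v).
Proof.
have [uv|/norP[]] := boolP ((v != 0) || (u != 0)).
  by apply: (@der1_comp _ Phi0 (wf^~ v)); [exact: der1_Phi0|exact: dx_lens].
rewrite !negbK => /eqP -> /eqP ->; have [_ -> _ _] := capped_low _ _ W00.
by apply: dx_origin => ? ? /capped_low[].
Qed.

Lemma dy_capped u v : der1 (capped u) v (capped_y u v).
Proof.
have [uv|/norP[]] := boolP ((v != 0) || (u != 0)).
  by apply: (@der1_comp _ Phi0 (wf u)); [exact: der1_Phi0|exact: dy_lens].
rewrite !negbK => /eqP -> /eqP ->; have [_ _ -> _] := capped_low _ _ W00.
by apply: dy_origin => ? ? /capped_low[].
Qed.

Lemma dx_capped_x u v : der1 (capped_x^~ v) u (capped_xx u v).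
Proof.
have [uv|/norP[]] := boolP ((v != 0) || (u != 0)).
  apply: der1_eq.
    rewrite /capped_x; der; [exact: der1_Phi1|exact: dx_lens|exact: dx_lens_x].
  by rewrite /capped_xx /=; ring.
rewrite !negbK => /eqP -> /eqP ->; have [_ _ _ [-> _ _]] := capped_low _ _ W00.
by apply: dx_origin => ? ? /capped_low[].
Qed.

Lemma dy_capped_x u v : der1 (capped_x u) v (capped_xy u v).
Proof.
have [uv|/norP[]] := boolP ((v != 0) || (u != 0)).
  apply: der1_eq.
    rewrite /capped_x; der; [exact: der1_Phi1|exact: dy_lens|exact: dy_lens_x].
  by rewrite /capped_xy /=; ring.
rewrite !negbK => /eqP -> /eqP ->; have [_ _ _ [_ -> _]] := capped_low _ _ W00.
by apply: dy_origin => ? ? /capped_low[].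
Qed.

Lemma dx_capped_y u v : der1 (capped_y^~ v) u (capped_xy u v).
Proof.
have [uv|/norP[]] := boolP ((v != 0) || (u != 0)).
  apply: der1_eq.
    rewrite /capped_y; der; [exact: der1_Phi1|exact: dx_lens|exact: dx_lens_y].
  by rewrite /capped_xy /=; ring.
rewrite !negbK => /eqP -> /eqP ->; have [_ _ _ [_ -> _]] := capped_low _ _ W00.
by apply: dx_origin => ? ? /capped_low[].
Qed.

Lemma dy_capped_y u v : der1 (capped_y u) v (capped_yy u v).
Proof.
have [uv|/norP[]] := boolP ((v != 0) || (u != 0)).
  apply: der1_eq.
    rewrite /capped_y; der; [exact: der1_Phi1|exact: dy_lens|exact: dy_lens_y].
  by rewrite /capped_yy /=; ring.
rewrite !negbK => /eqP -> /eqP ->; have [_ _ _ [_ _ ->]] := capped_low _ _ W00.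
by apply: dy_origin => ? ? /capped_low[].
Qed.

Lemma grad_bound (p q : R) : `|p| <= 1 -> `|q| <= 8 * b * m -> `|p * q| <= 8 * b * m.
Proof. by move=> p1 q1; rewrite normrM -[leRHS]mul1r ler_pM. Qed.

Lemma capped_x_bound u v : `|capped_x u v| <= 8 * b * m.
Proof. by apply: grad_bound; [exact: Phi1_bound|exact: lens_x_bound]. Qed.

Lemma capped_y_bound u v : `|capped_y u v| <= 8 * b * m.
Proof. by apply: grad_bound; [exact: Phi1_bound|exact: lens_y_bound]. Qed.

(** Chain rule with weight [wf u v]: in units of [(b * m) ^+ 2] the term with [Phi2] contributes
    [3 * 8 * 8 = 192] and the other one [96]. The bound does not involve [e]. *)
Lemma hessW_bound u v (p q r : R) : `|p| <= 8 * b * m -> `|q| <= 8 * b * m ->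
  `|r| * wf u v <= 96 * (b * m) ^+ 2 ->
  `|Phi2 (wf u v) * p * q + Phi1 (wf u v) * r| * wf u v <= 288 * (b * m) ^+ 2.
Proof.
move=> p8 q8 r9; have w0 := lens_ge0 b m b_gt0 m_ge1 u v.
have P2 := @Phi2_bound R e (8 * b) e_gt0 d_gt0 _ w0.
have P1 := Phi1_bound e (8 * b) (wf u v).
have bm0 : 0 <= 8 * b * m by apply: le_trans p8.
rewrite -[X in _ * X <= _](ger0_norm w0) -normrM mulrDl.
rewrite (le_trans (ler_normD _ _)) //.
have -> : 288 * (b * m) ^+ 2 = 3 * ((8 * b * m) * (8 * b * m)) + 96 * (b * m) ^+ 2 by ring.
apply: lerD.
  rewrite (_ : _ * wf u v = Phi2 (wf u v) * wf u v * (p * q)); last by ring.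
  by rewrite normrM; apply: ler_pM => //; rewrite normrM; apply: ler_pM.
rewrite -mulrA normrM normrM (ger0_norm w0).
by rewrite (le_trans _ r9) // ler_piMl // mulr_ge0.
Qed.

Lemma capped_xx_bound u v : `|capped_xx u v| * wf u v <= 288 * (b * m) ^+ 2.
Proof.
rewrite /capped_xx expr2 mulrA.
by apply: hessW_bound; [exact: lens_x_bound|exact: lens_x_bound|exact: lens_xx_bound].
Qed.

Lemma capped_xy_bound u v : `|capped_xy u v| * wf u v <= 288 * (b * m) ^+ 2.
Proof.
by apply: hessW_bound; [exact: lens_x_bound|exact: lens_y_bound|exact: lens_xy_bound].
Qed.

Lemma capped_yy_bound u v : `|capped_yy u v| * wf u v <= 288 * (b * m) ^+ 2.
Proof.
rewrite /capped_yy expr2 mulrA.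
by apply: hessW_bound; [exact: lens_y_bound|exact: lens_y_bound|exact: lens_yy_bound].
Qed.

(** Serves the Sobolev regularity of the gradient, where the dependence on [e] is harmless. *)
Lemma hess_bound_of_low (g : R -> R -> R) : (forall u v, wf u v <= e -> g u v = 0) ->
  (forall u v, `|g u v| * wf u v <= 288 * (b * m) ^+ 2) ->
  forall u v, `|g u v| <= 288 * (b * m) ^+ 2 / e.
Proof.
move=> g0 gw u v; case: (leP (wf u v) e) => [/g0 ->|we].
  by rewrite normr0; apply: divr_ge0 (ltW e_gt0); exact: mulr_ge0 (ler0n _ _) (sqr_ge0 _).
rewrite ler_pdivlMr // (le_trans _ (gw u v)) // ler_wpM2l //.
exact: ltW.
Qed.

End OutOfPlane.

(** * The in-plane displacement *)

Section InPlane.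
Context {R : realType}.
Variables (b m : R).
Hypotheses (b_gt0 : 0 < b) (m_ge1 : 1 <= m).
(* The gradient image of the lens function has area [pi], as for the cone. *)
Hypothesis bm_pi : b ^+ 2 * m * (576 / 35) = pi / 4.
Implicit Types (u v t : R).

Let m_gt0 : 0 < m. Proof. exact: lt_le_trans m_ge1. Qed.

Definition legI t : R := I0 (cl t) - cl t * F1 (cl t) ^+ 2.
Definition legQ t : R := Q0 (cl t) - cl t * Q1 (cl t).

Lemma sgr_sqr t : t != 0 -> Num.sg t ^+ 2 = 1.
Proof. by move=> t0; rewrite sqr_sg t0. Qed.

(** The offset [1152 / 35] is [64 - I0 1]. Times [b ^+ 2 * m / 2] it becomes [pi / 4] by [bm_pi],
    which compensates the jump of [atan (u / v) / 2] between [pi / 4] and [- pi / 4] across the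
    [x_1] axis. *)
Lemma fI_out t : 1 <= `|t| -> fI t = 64 * t - 1152 / 35 * Num.sg t.
Proof.
move=> t1; rewrite /fI /ext cl_sg // /I0 /F1.
have /sgr_sqr : t != 0 by rewrite -normr_gt0; lra.
move: (Num.sg t) => s s2.
rewrite (_ : s ^+ 3 = s * s ^+ 2); last by ring.
rewrite (_ : s ^+ 5 = s * (s ^+ 2) ^+ 2); last by ring.
rewrite (_ : s ^+ 7 = s * (s ^+ 2) ^+ 3); last by ring.
rewrite s2 (_ : (12 * s - _) ^+ 2 = 64 * s ^+ 2); last by ring.
by rewrite s2; field.
Qed.

Lemma fQ_out t : 1 <= `|t| -> fQ t = 576 / 35 * (t * Num.sg t).
Proof.
move=> t1; rewrite /fQ /ext cl_sg // /Q0 /Q1.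
have /sgr_sqr : t != 0 by rewrite -normr_gt0; lra.
move: (Num.sg t) => s s2.
rewrite (_ : s ^+ 3 = s * s ^+ 2); last by ring.
rewrite (_ : s ^+ 4 = (s ^+ 2) ^+ 2); last by ring.
rewrite (_ : s ^+ 5 = s * (s ^+ 2) ^+ 2); last by ring.
rewrite (_ : s ^+ 6 = (s ^+ 2) ^+ 3); last by ring.
rewrite (_ : s ^+ 7 = s * (s ^+ 2) ^+ 3); last by ring.
rewrite (_ : s ^+ 8 = (s ^+ 2) ^+ 4); last by ring.
rewrite s2.
transitivity (576 / 35 * (t * s) + 576 / 35 * (1 - s ^+ 2)); first by field.
by rewrite s2; ring.
Qed.

Lemma atan_inv t : t != 0 -> atan t = Num.sg t * (pi / 2) - atan t^-1.
Proof.
case: sgrP => // t0 _; first by rewrite atanV //; ring.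
have s0 : 0 < - t by rewrite oppr_gt0.
by have := atanV _ s0; rewrite invrN !atanN; lra.
Qed.

(* Compensates, as a function of [x_1] alone, the upper transition of [Phi0]. *)
Definition chi0 t : R := 32 * b ^+ 2 * m * (fK (m * t - 2) - fK (- (m * t) - 2)).
Definition chi1 t : R := 32 * (b * m) ^+ 2 *
  ((1 - (1 - s1 (m * t - 2)) ^+ 2) + (1 - (1 - s1 (- (m * t) - 2)) ^+ 2)).

Lemma der1_chi0 t : der1 chi0 t (chi1 t).
Proof.
apply: der1_eq; first by rewrite /chi0; der; [exact: der1_fK|exact: der1_fK].
by rewrite /chi1 /=; ring.
Qed.

(** Only one of the two terms can be active for a given sign of [t]. The argument [m * |t| - 2] is
    that of the upper transition in the sectors, where the lens equals [8 b m |t|]. *)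
Lemma chi1E t : chi1 t = 32 * (b * m) ^+ 2 * (1 - (1 - s1 (m * `|t| - 2)) ^+ 2).
Proof.
rewrite /chi1; case: (leP 0 t) => t0.
  rewrite (ger0_norm t0) (s1_low (- (m * t) - 2)); first by ring.
  by have := mulr_ge0 (ltW m_gt0) t0; lra.
rewrite (ltr0_norm t0) (s1_low (m * t - 2)).
  by rewrite mulrN; ring.
by have := mulr_gt0 m_gt0 (_ : 0 < - t); rewrite oppr_gt0 => /(_ t0); lra.
Qed.

(* [phi x^perp / 2 - V], where [phi = atan (x_1 / x_2)] is the clockwise angle from
   the [x_2] axis and [V] solves [2 e(V) = Dw (x) Dw] for the lens [w]; [bm_pi] makes
   the two branches [x_2 > 0] and [x_2 < 0] match across the [x_1] axis. *)
Definition disp_u u v : R := (if v == 0 then - (32 * (b * m) ^+ 2 * u) else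
  v * (- (atan (u / v) / 2) - b ^+ 2 * m / 2 * fI (m * (u / v)))) + chi0 u.
Definition disp_v u v : R :=
  v * (u / v * atan (u / v) / 2 - b ^+ 2 * fQ (m * (u / v))).

Definition disp_u_x u v : R := (if v == 0 then - (32 * (b * m) ^+ 2) else
  - (1 + (u / v) ^+ 2)^-1 / 2 - (b * m) ^+ 2 / 2 * f1 (m * (u / v)) ^+ 2) + chi1 u.
Definition disp_u_y u v : R := if v == 0 then 0 else
  - (atan (u / v) / 2) + u / v * (1 + (u / v) ^+ 2)^-1 / 2
  - b ^+ 2 * m / 2 * legI (m * (u / v)).
Definition disp_v_x u v : R := if v == 0 then 0 else
  atan (u / v) / 2 + u / v * (1 + (u / v) ^+ 2)^-1 / 2
  - b ^+ 2 * m * Q1 (cl (m * (u / v))).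
(** The origin needs its own value: there the derivative is taken along the [x_2] axis, on which
    [disp_v] is linear. *)
Definition disp_v_y u v : R :=
  if v == 0 then (if u == 0 then - (b ^+ 2 * fQ 0) else - (1 / 2)) else
  - ((u / v) ^+ 2 * (1 + (u / v) ^+ 2)^-1 / 2) - b ^+ 2 * legQ (m * (u / v)).

Lemma der1_atan t : der1 atan t (1 + t ^+ 2)^-1.
Proof. exact: is_derive1_atan. Qed.

Lemma dx_disp_u u v : der1 (disp_u^~ v) u (disp_u_x u v).
Proof.
rewrite /disp_u /disp_u_x; case: eqVneq => [_|v0].
  by apply: der1_eq; [der; exact: der1_chi0|rewrite /=; ring].
apply: der1_eq; first by der; [exact: der1_atan|exact: der1_fI|exact: der1_chi0].
rewrite /=; set k := (1 + _ ^+ 2)^-1.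
by field; exact: v0.
Qed.

Lemma near0_nz (P : R -> Prop) : P 0 -> (\forall t \near (0 : R), t != 0 -> P t) ->
  \forall t \near (0 : R), P t.
Proof. by move=> P0; apply: filterS => t; case: (eqVneq t 0) => [->|? /(_ isT)]. Qed.

Lemma dy_disp_u u v : der1 (disp_u u) v (disp_u_y u v).
Proof.
have [->|v0] := eqVneq v 0.
  rewrite /disp_u_y eqxx; have [->|u0] := eqVneq u 0.
    apply: (@der1_near _ _ (fun t => chi0 0)); last exact: der1_const.
    near=> t; rewrite /disp_u mul0r atan0 mulr0 mul0r oppr0.
    have -> : fI (0 : R) = 0.
      by rewrite /fI /ext /I0 /F1; case: clP => *; try lra; ring.
    by case: ifP => _; ring.
  apply: (@der1_near _ _ (fun t => t * (atan (t / u) / 2) - 32 * (b * m) ^+ 2 * u + chi0 u)).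
    apply: near0_nz; first by rewrite /disp_u eqxx; ring.
    apply: filterS (near_slope _ m_ge1 _ u0) => t + t0 => /(_ t0) h.
    rewrite /disp_u (negbTE t0) fI_out //; congr (_ + _).
    have ut0 : u / t != 0 by rewrite mulf_neq0 // invr_eq0.
    rewrite (atan_inv _ ut0) invf_div (sgrM m) (gtr0_sg m_gt0) mul1r.
    (* The terms with [Num.sg] are the mismatch of the two branches across the [x_1] axis; their
       coefficient vanishes by [bm_pi]. *)
    transitivity (t * (atan (t / u) / 2) - 32 * (b * m) ^+ 2 * u
      + t * Num.sg (u / t) * (b ^+ 2 * m * (576 / 35) - pi / 4)); last first.
      by rewrite bm_pi subrr mulr0 addr0.
    by field; exact: t0.
  apply: der1_eq; first by der; exact: der1_atan.
  by rewrite /= mul0r atan0; ring.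
apply: (@der1_near _ _ (fun t => t * (- (atan (u / t) / 2) - b ^+ 2 * m / 2 * fI (m * (u / t)))
   + chi0 u)).
  by apply: filterS (near_neq0 _ v0) => t t0; rewrite /disp_u (negbTE t0).
apply: der1_eq; first by der; [exact: der1_atan|exact: v0|exact: der1_fI|exact: v0].
rewrite /disp_u_y (negbTE v0) /legI -(ext_legendre I0 (fun c => F1 c ^+ 2)) -/(fI _) -/(f1 _) /=.
set k := (1 + _ ^+ 2)^-1.
by field; exact: v0.
Unshelve. all: by end_near. Qed.

Lemma dx_disp_v u v : der1 (disp_v^~ v) u (disp_v_x u v).
Proof.
rewrite /disp_v /disp_v_x; case: eqVneq => [->|v0].
  apply: (@der1_near _ _ (fun=> 0)); last exact: der1_const.
  by near=> t; rewrite mul0r.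
apply: der1_eq; first by der; [exact: der1_atan|exact: der1_fQ].
rewrite /=; set k := (1 + _ ^+ 2)^-1.
by field; exact: v0.
Unshelve. all: by end_near. Qed.

Lemma dy_disp_v u v : der1 (disp_v u) v (disp_v_y u v).
Proof.
have [->|v0] := eqVneq v 0.
  rewrite /disp_v_y eqxx; case: eqVneq => [->|u0].
    apply: (@der1_near _ _ (fun t => - (b ^+ 2 * fQ 0) * t)).
      by near=> t; rewrite /disp_v mul0r mulr0; ring.
    by apply: der1_eq; [der|rewrite /=; ring].
  apply: (@der1_near _ _ (fun t => - (u * (atan (t / u) / 2)))).
    apply: near0_nz; first by rewrite /disp_v !mul0r atan0; ring.
    apply: filterS (near_slope _ m_ge1 _ u0) => t + t0 => /(_ t0) h.
    rewrite /disp_v fQ_out //.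
    have ut0 : u / t != 0 by rewrite mulf_neq0 // invr_eq0.
    rewrite (atan_inv _ ut0) invf_div (sgrM m) (gtr0_sg m_gt0) mul1r.
    (* The same mismatch, now with the factor [u] in place of [t]. *)
    transitivity (- (u * (atan (t / u) / 2))
      - u * Num.sg (u / t) * (b ^+ 2 * m * (576 / 35) - pi / 4)); last first.
      by rewrite bm_pi subrr mulr0 subr0.
    by field; exact: t0.
  apply: der1_eq; first by der; exact: der1_atan.
  by rewrite /= !mul0r expr0n /= addr0; field; exact: u0.
apply: der1_eq; first by rewrite /disp_v; der; [exact: v0|exact: der1_atan|exact: v0|exact: der1_fQ|exact: v0].
rewrite /disp_v_y (negbTE v0) /legQ -(ext_legendre Q0 Q1) -/(fQ _) /=.
set k := (1 + _ ^+ 2)^-1.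
by field; exact: v0.
Unshelve. all: by end_near. Qed.

End InPlane.

(** * Vanishing and boundedness of the membrane strain *)

Section Strain.
Context {R : realType}.
Variables (b m e : R).
Hypotheses (b_gt0 : 0 < b) (m_ge1 : 1 <= m) (e_gt0 : 0 < e) (e_le : e <= 8 * b).
Hypothesis bm_pi : b ^+ 2 * m * (576 / 35) = pi / 4.
Implicit Types (u v t : R).

Let d_gt0 : 0 < 8 * b. Proof. by rewrite mulr_gt0. Qed.
Let m_gt0 : 0 < m. Proof. exact: lt_le_trans m_ge1. Qed.

(** For [v != 0] each equation splits into an angular identity in [k = (1 + (u / v)^2)^-1] and a
    polynomial identity in the clamped slope [c]; the arctangents cancel in the shear. [chi1] is
    taken out because it belongs to the flattened sheet and not to the lens. *)
Lemma lens_strain u v : (v != 0) || (u != 0) ->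
  [/\ 2 * (disp_u_x b m u v - chi1 b m u) + lens_x b m u v ^+ 2 + v ^+ 2 / (u ^+ 2 + v ^+ 2) = 0,
      2 * disp_v_y b m u v + lens_y b m u v ^+ 2 + u ^+ 2 / (u ^+ 2 + v ^+ 2) = 0 &
      disp_u_y b m u v + disp_v_x b m u v + lens_x b m u v * lens_y b m u v - u * v / (u ^+ 2 + v ^+ 2) = 0].
Proof.
rewrite /disp_u_x /disp_v_y /disp_u_y /disp_v_x /lens_x /lens_y; have [->|v0 _] := eqVneq v 0.
  move=> /= u0; rewrite (negbTE u0); split; last by ring.
    rewrite (_ : (_ * Num.sg u) ^+ 2 = 64 * (b * m) ^+ 2 * Num.sg u ^+ 2); last by ring.
    by rewrite (sgr_sqr _ u0); field; exact: u0.
  by field; exact: u0.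
have s2 := sgr_sqr _ v0.
have r0 : v ^+ 2 + u ^+ 2 != 0.
  by rewrite gt_eqF // ltr_pwDl ?sqr_ge0 // exprn_even_gt0.
have k1 : v ^+ 2 / (u ^+ 2 + v ^+ 2) = (1 + (u / v) ^+ 2)^-1.
  by field; rewrite v0 ?r0 /= ?(addrC (u ^+ 2)) ?r0.
have k2 : u ^+ 2 / (u ^+ 2 + v ^+ 2) = (u / v) ^+ 2 * (1 + (u / v) ^+ 2)^-1.
  by field; rewrite v0 ?r0 /= ?(addrC (u ^+ 2)) ?r0.
have k3 : u * v / (u ^+ 2 + v ^+ 2) = u / v * (1 + (u / v) ^+ 2)^-1.
  by field; rewrite v0 ?r0 /= ?(addrC (u ^+ 2)) ?r0.
rewrite k1 k2 k3; move: (1 + _ ^+ 2)^-1 => k.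
rewrite /f1 /leg /legI /legQ; move: (cl _) => c; split.
- rewrite (_ : (_ * Num.sg v * _) ^+ 2 = (b * m) ^+ 2 * F1 c ^+ 2 * Num.sg v ^+ 2); last by ring.
  by rewrite s2; field.
- rewrite (_ : (_ * Num.sg v * _) ^+ 2 = b ^+ 2 * (F0 c - c * F1 c) ^+ 2 * Num.sg v ^+ 2); last by ring.
  by rewrite s2 /F0 /F1 /Q0 /Q1; field.
- rewrite (_ : _ * Num.sg v * _ * _ = b ^+ 2 * m * F1 c * (F0 c - c * F1 c) * Num.sg v ^+ 2); last by ring.
  by rewrite s2 /F0 /F1 /I0 /Q1; field.
Qed.

(** Outside the sectors [f0 <= 8] and [|v| < 1] keep the lens below [8 b]. Hence flattening from
    that level on only meets a function of [u]. *)
Lemma lens_cylinder u v : u ^+ 2 + v ^+ 2 < 1 -> 8 * b <= lens b m u v ->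
  [/\ lens b m u v = 8 * b * m * `|u|, lens_y b m u v = 0 & lens_x b m u v ^+ 2 = 64 * (b * m) ^+ 2].
Proof.
move=> r1; rewrite /lens /lens_x /lens_y; case: eqVneq => [_|v0] h.
  split => //; rewrite exprMn sgr_sqr; first by ring.
  apply/eqP => u0; move: h; rewrite u0 normr0 mulr0; have := b_gt0; lra.
have v1 : `|v| < 1.
  rewrite -(@expr_lt1 _ 2) // real_normK ?num_real //.
  by have := sqr_ge0 u; lra.
have p1 : 1 <= `|m * (u / v)|.
  rewrite leNgt; apply/negP => /ltW/f0_le8 f8.
  have bv : b * `|v| < b by rewrite gtr_pMr.
  have f3 := f0_ge3 (m * (u / v)).
  have : b * `|v| * f0 (m * (u / v)) <= b * `|v| * 8 by rewrite ler_wpM2l // mulr_ge0 // ltW.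
  by lra.
have p0 : m * (u / v) != 0 by rewrite -normr_gt0; lra.
split; last first.
- rewrite /f1 /F1 cl_sg //; have sv := sgr_sqr _ v0.
  have := sgr_sqr _ p0; move: (Num.sg (m * _)) => s s2.
  rewrite (_ : (_ * (_ - _)) ^+ 2 = (b * m) ^+ 2 * (Num.sg v ^+ 2) * (s ^+ 2 * (12 - 4 * s ^+ 2) ^+ 2)); last by ring.
  by rewrite s2 sv; ring.
- by rewrite leg_out // mulr0.
- rewrite f0_out // !normrM normfV (gtr0_norm m_gt0); field.
  by rewrite normr_eq0.
Qed.

(** From [3 e] on the lower transition is complete. If the lens is at least [8 b], the point is in
    the sectors and [chi1] is half the lost squared slope; otherwise [8 b m |u| < 8 b] keeps [chi1]
    at zero. *)
Lemma capped_lens u v : u ^+ 2 + v ^+ 2 < 1 -> 3 * e <= lens b m u v ->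
  [/\ capped_x b m e u v ^+ 2 = lens_x b m u v ^+ 2 - 2 * chi1 b m u,
      capped_y b m e u v ^+ 2 = lens_y b m u v ^+ 2 &
      capped_x b m e u v * capped_y b m e u v = lens_x b m u v * lens_y b m u v].
Proof.
move=> r1 w3; rewrite /capped_x /capped_y /Phi1 s1_high; last first.
  have : 3 <= lens b m u v / e by rewrite ler_pdivlMr.
  lra.
rewrite chi1E //; case: (leP (8 * b) (lens b m u v)) => wd.
  have [-> -> ->] := lens_cylinder _ _ r1 wd; split; [|ring|ring].
  rewrite exprMn; have [_ _ ->] := lens_cylinder _ _ r1 wd.
  rewrite (_ : 8 * b * m * `|u| / (8 * b) = m * `|u|); first by ring.
  by field; rewrite gt_eqF.
rewrite (s1_low (lens b m u v / _ - 2)); last first.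
  have : lens b m u v / (8 * b) <= 1 by rewrite ler_pdivrMr // mul1r ltW.
  lra.
rewrite s1_low; last first.
  have : m * `|u| <= 1.
    rewrite -(ler_pM2l d_gt0) mulr1 mulrA.
    by apply: le_trans (ltW wd); exact: lens_gex.
  lra.
by split; ring.
Qed.

Lemma strain_free u v : u ^+ 2 + v ^+ 2 < 1 -> 3 * e <= lens b m u v ->
  [/\ 2 * disp_u_x b m u v + capped_x b m e u v ^+ 2 + v ^+ 2 / (u ^+ 2 + v ^+ 2) = 0,
      2 * disp_v_y b m u v + capped_y b m e u v ^+ 2 + u ^+ 2 / (u ^+ 2 + v ^+ 2) = 0 &
      disp_u_y b m u v + disp_v_x b m u v + capped_x b m e u v * capped_y b m e u v
        - u * v / (u ^+ 2 + v ^+ 2) = 0].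
Proof.
move=> r1 w3; have uv : (v != 0) || (u != 0).
  have [v0|//] := eqVneq v 0; have [u0|//] := eqVneq u 0.
  by move: w3; rewrite u0 v0 lens00; have := e_gt0; lra.
have [-> -> ->] := capped_lens _ _ r1 w3.
have [h1 h2 h3] := lens_strain _ _ uv; split => //.
by rewrite -[RHS]h1; ring.
Qed.

Lemma clamp_bounded (g g' : R -> R) : (forall c, der1 g c (g' c)) ->
  exists C : R, 0 <= C /\ forall t, `|g (cl t)| <= C.
Proof.
move=> dg; have [||c _ cmax] := @EVT_max R (fun c => `|g c|) (-1) 1; first lra.
  apply: continuous_subspaceT => x; apply: continuous_comp; last exact: norm_continuous.
  exact: is_derive_continuous dg x.
exists `|g c|; split => // t; apply: cmax.
by rewrite in_itv /=; exact: cl_bound.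
Qed.

Lemma inv1p_bound t : 0 <= (1 + t ^+ 2)^-1 <= 1 /\ `|t * (1 + t ^+ 2)^-1| <= 1
  /\ 0 <= t ^+ 2 * (1 + t ^+ 2)^-1 <= 1.
Proof.
have t2 := sqr_ge0 t; have k0 : 0 < 1 + t ^+ 2 by lra.
split; first by rewrite invr_ge0 ltW //= invf_le1 //; lra.
split; last by rewrite mulr_ge0 ?invr_ge0 ?(ltW k0) //= ler_pdivrMr // mul1r; lra.
rewrite normrM (gtr0_norm (_ : 0 < (1 + t ^+ 2)^-1)) ?invr_gt0 // ler_pdivrMr // mul1r.
rewrite -(real_normK (num_real t)); have := sqr_ge0 (`|t| - 1 / 2); nra.
Qed.

Lemma chi1_bound t : `|chi1 b m t| <= 32 * (b * m) ^+ 2.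
Proof.
have bm2 := sqr_ge0 (b * m).
rewrite chi1E //; have := s1_bounds (m * `|t| - 2); move: (s1 _) => s s01.
have h0 : 0 <= 1 - (1 - s) ^+ 2 by nra.
have h1 : 1 - (1 - s) ^+ 2 <= 1 by have := sqr_ge0 (1 - s); lra.
rewrite ger0_norm; last by apply: mulr_ge0 => //; lra.
by rewrite ler_piMr //; lra.
Qed.

(** The clamped polynomials are bounded by compactness of [[-1, 1]], the angular terms by elementary
    estimates. The constant does not involve [e], hence is uniform in [h]. *)
Lemma disp_bound : exists C : R, 0 <= C /\ forall u v,
  [/\ `|disp_u_x b m u v| <= C, `|disp_u_y b m u v| <= C, `|disp_v_x b m u v| <= C & `|disp_v_y b m u v| <= C].
Proof.
have dQ1 (c : R) : der1 Q1 c (36 * (1 - c ^+ 2) ^+ 3).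
  by apply: der1_eq; [rewrite /Q1; der|rewrite /=; field].
have [CI [CI0 CIb]] : exists C : R, 0 <= C /\ forall t, `|legI t| <= C.
  apply: (clamp_bounded (fun c => I0 c - c * F1 c ^+ 2) (fun c => - (2 * c * F1 c * F2 c))).
  move=> c; apply: der1_eq; first by der; [exact: der1_I0|exact: der1_F1].
  by rewrite /=; ring.
have [CQ [CQ0 CQb]] : exists C : R, 0 <= C /\ forall t, `|legQ t| <= C.
  apply: (clamp_bounded (fun c => Q0 c - c * Q1 c) (fun c => - (c * (36 * (1 - c ^+ 2) ^+ 3)))).
  move=> c; apply: der1_eq; first by der; [exact: der1_Q0|exact: dQ1].
  by rewrite /=; ring.
have [C1 [C10 C1b]] := clamp_bounded Q1 _ dQ1.
have bm2 : 0 <= b ^+ 2 * m by rewrite mulr_ge0 ?sqr_ge0 // ltW.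
have bmm : 0 <= (b * m) ^+ 2 by exact: sqr_ge0.
have b2 : 0 <= b ^+ 2 by exact: sqr_ge0.
have B (k p c : R) : 0 <= k -> `|p| <= c -> - (k * c) <= k * p <= k * c.
  move=> k0; rewrite ler_norml => /andP[p1 p2].
  by rewrite -mulrN !ler_wpM2l.
have pi2 := pi_ge2 R; have pi4 : (pi : R) <= 4 by have := pihalf_lt2 R; lra.
have f18 t : 0 <= f1 t ^+ 2 <= 64.
  have := s1_bounds t; rewrite /s1 sqr_ge0 => ?; nra.
pose C := 10 + 64 * (b * m) ^+ 2 + b ^+ 2 * m * CI + b ^+ 2 * m * C1 + b ^+ 2 * CQ
  + b ^+ 2 * `|fQ 0|.
have n1 := mulr_ge0 bm2 CI0; have n2 := mulr_ge0 bm2 C10; have n3 := mulr_ge0 b2 CQ0.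
have n4 := mulr_ge0 b2 (normr_ge0 (fQ 0)).
have C0 : 0 <= C by rewrite /C; lra.
exists C; split => // u v; rewrite /disp_u_x /disp_u_y /disp_v_x /disp_v_y.
have [/andP[k0 k1] [+ /andP[k2 k3]]] := inv1p_bound (u / v).
rewrite ler_norml => /andP[k4 k5].
have := atan_bound (u / v); rewrite ler_norml => /andP[a1 a2].
have /andP[i1 i2] := B _ _ _ bm2 (CIb (m * (u / v))).
have /andP[j1 j2] := B _ _ _ bm2 (C1b (m * (u / v))).
have /andP[q1 q2] := B _ _ _ b2 (CQb (m * (u / v))).
have /andP[z1 z2] := B _ _ _ b2 (lexx `|fQ 0|).
have := chi1_bound u; rewrite ler_norml => /andP[c1 c2].
have /andP[e1 e2] := f18 (m * (u / v)).
have g1 : 0 <= (b * m) ^+ 2 * f1 (m * (u / v)) ^+ 2 by rewrite mulr_ge0.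
have g2 : (b * m) ^+ 2 * f1 (m * (u / v)) ^+ 2 <= (b * m) ^+ 2 * 64 by rewrite ler_wpM2l.
move: k0 k1 k2 k3 k4 k5 a1 a2 i1 i2 j1 j2 q1 q2 c1 c2 g1 g2 z1 z2 n1 n2 n3 n4.
rewrite /C.
have nf : b ^+ 2 * fQ 0 <= b ^+ 2 * `|fQ 0| by rewrite ler_wpM2l // ler_norm.
have nf' : - (b ^+ 2 * `|fQ 0|) <= b ^+ 2 * fQ 0.
  by rewrite -mulrN ler_wpM2l // lerNl -normrN ler_norm.
case: eqVneq => _ *; split; rewrite ?normr0; try (rewrite ler_norml; lra).
  lra.
  lra.
by case: ifP => _; rewrite ler_norml; lra.
Qed.

End Strain.

(** * Integration over layers *)

Section Layers.
Context {R : realType}.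

(** Either [N] lies between two consecutive powers of [t], or [k = n] and the point is in the core.
    With [n = 6] this gives seven squares, the smallest of half-width [t ^ 6]. *)
Lemma layer_of (t N : R) (n : nat) : N <= 1 ->
  exists k, [/\ (k <= n)%N, N <= t ^+ k & k = n \/ t ^+ k.+1 < N].
Proof.
move=> N1; elim: n => [|n [k [kn Nk H]]]; first by exists 0%N; split; [|rewrite expr0|left].
case: H => [kE|H]; last by exists k; split; [exact: leqW| |right].
case: (leP N (t ^+ n.+1)) => h; first by exists n.+1; split; [| |left].
by exists k; split; [exact: leqW| |right; rewrite kE].
Qed.

(* With [h = t ^ 6]: [g <= C min(1, h^2/|x|^2)], summed over squares of half-width [t^k]. *)
Lemma layered_integral (g : R * R -> R) (C t : R) : 0 <= C -> 0 < t <= 1 ->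
  measurable_fun (@B1 R) g -> (forall x, B1 x -> 0 <= g x) ->
  (forall x, B1 x -> g x <= C) ->
  (forall x, B1 x -> g x * Num.max `|x.1| `|x.2| ^+ 2 <= C * (t ^+ 6) ^+ 2) ->
  (\int[@leb2 R]_(x in @B1 R) (g x)%:E <= (28 * C * t ^+ 10)%:E)%E.
Proof.
move=> C0 /andP[t0 t1] mg g0 gC gN.
(* Bound for [g] where the max norm exceeds [t ^ (k + 1)]; for [k = 6] the factor is
   [t ^ (-2) >= 1], so the plain bound [C] is covered too. A square of measure [4 t ^ (2 k)] then
   contributes at most [4 C t ^ 10], and there are seven. *)
pose c (k : nat) := C * (t ^+ 6 / t ^+ k.+1) ^+ 2.
have c0 k : 0 <= c k by rewrite mulr_ge0 ?sqr_ge0.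
have mB := @measurable_B1 R.
have mI (k : nat) : measurable_fun (@B1 R) (fun x => ((c k)%:E * (\1_(box (t ^+ k)) x)%:E)%E).
  apply: emeasurable_funM; first exact: measurable_cst.
  by apply/measurable_EFinP; apply: measurable_indic; exact: measurable_box.
have I0 (k : nat) x : (0 <= (c k)%:E * (\1_(box (t ^+ k)) x)%:E)%E.
  by apply: mule_ge0; rewrite lee_fin.
apply: (@le_trans _ _ (\int[@leb2 R]_(x in @B1 R)
   \sum_(k < 7) ((c k)%:E * (\1_(box (t ^+ k)) x)%:E))%E).
  apply: ge0_le_integral => //.
  - exact/measurable_EFinP.
  - by apply: emeasurable_sum => k; exact: mI.
  move=> x Bx; have [x1 x2] := B1_box _ Bx.
  set N := Num.max `|x.1| `|x.2| in gN.
  have N1 : N <= 1 by rewrite ge_max x1.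
  have [k [k6 Nk kN]] := @layer_of t N 6 N1.
  rewrite (bigD1 (Ordinal (k6 : (k < 7)%N))) //= -[leLHS]adde0; apply: leeD; last first.
    by apply: sume_ge0 => j _.
  rewrite indicE mem_set; last by apply/boxP; move: Nk; rewrite ge_max => /andP.
  rewrite mule1 lee_fin /c; case: kN => [->|kN].
    rewrite (le_trans (gC x Bx)) // ler_peMr // exprn_ege1 //.
    by rewrite ler_pdivlMr ?exprn_gt0 // mul1r exprSr ler_piMr // exprn_ge0 // ltW.
  have tk : 0 < t ^+ k.+1 by rewrite exprn_gt0.
  rewrite expr_div_n mulrA ler_pdivlMr ?exprn_gt0 //.
  rewrite (le_trans _ (gN x Bx)) // ler_wpM2l ?g0 //.
  by rewrite lerXn2r ?nnegrE ?(ltW tk) ?(ltW kN) // (le_trans (ltW tk)) // ltW.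
rewrite ge0_integral_sum //.
apply: (@le_trans _ _ (\sum_(k < 7) (4 * C * t ^+ 10)%:E)%E); last first.
  rewrite sumEFin lee_fin big_const_ord iter_addr addr0 -mulr_natr; lra.
apply: lee_sum => k _.
rewrite ge0_integralZl //; last by rewrite lee_fin.
  rewrite integral_indic //; last exact: measurable_box.
  apply: (@le_trans _ _ ((c k)%:E * @leb2 R (box (t ^+ k)))%E).
    apply: lee_pmul => //; rewrite ?lee_fin //.
    apply: le_measure; rewrite ?inE; [|exact: measurable_box|by move=> x []].
    by apply: measurableI => //; exact: measurable_box.
  rewrite leb2_box ?exprn_ge0 ?(ltW t0) // -EFinM lee_fin /c.
  have tk : t ^+ k != 0 by rewrite gt_eqF // exprn_gt0.
  rewrite (exprS t k); move: (t ^+ k) tk => y y0; rewrite le_eqVlt; apply/orP; left; apply/eqP.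
  by field; rewrite y0 gt_eqF.
by apply/measurable_EFinP; apply: measurable_indic; exact: measurable_box.
by move=> k; exact: mI.
Qed.

End Layers.

(** * The competitor *)

Section Competitor.
Context {R : realType}.
Implicit Types (x : R * R) (i j : 'I_2).

Lemma ord2P i : i = ord0 \/ i = ord_max.
Proof. by case: i => -[|[|//]] h; [left|right]; apply: val_inj. Qed.

Definition uncur (g : R -> R -> R) x : R := g x.1 x.2.

Lemma is_derive_uncur (g g1 g2 : R -> R -> R) :
  (forall u v, der1 (g^~ v) u (g1 u v)) -> (forall u v, der1 (g u) v (g2 u v)) ->
  forall i x, is_derive x (edir R i) (uncur g) ((if i == ord0 then g1 else g2) x.1 x.2).
Proof.
move=> dg1 dg2 i x; apply/is_derive_line; rewrite /line /crd /uncur.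
by case: (i == ord0); [exact: dg1|exact: dg2].
Qed.

Lemma pd_uncur (g g1 g2 : R -> R -> R) :
  (forall u v, der1 (g^~ v) u (g1 u v)) -> (forall u v, der1 (g u) v (g2 u v)) ->
  forall i, pd i (uncur g) = uncur (if i == ord0 then g1 else g2).
Proof.
move=> dg1 dg2 i; apply/funext => x.
by have [_ H] := is_derive_uncur g g1 g2 dg1 dg2 i x; exact: H.
Qed.

Lemma W12_uncur (g g1 g2 : R -> R -> R) (M : R) :
  (forall u v, der1 (g^~ v) u (g1 u v)) -> (forall u v, der1 (g u) v (g2 u v)) ->
  (forall u v, `|g1 u v| <= M) -> (forall u v, `|g2 u v| <= M) ->
  W12 (uncur g) (fun i => pd i (uncur g)) /\ continuous (uncur g).
Proof.
move=> dg1 dg2 g1M g2M.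
have dg i x : derivable (uncur g) x (edir R i).
  by have [] := is_derive_uncur g g1 g2 dg1 dg2 i x.
have gM i x : `|pd i (uncur g) x| <= M.
  by rewrite (pd_uncur g g1 g2 dg1 dg2) /uncur; case: (i == ord0).
by split; [exact: W12_pd_bounded dg gM|exact: pd_bounded_continuous dg gM].
Qed.

Lemma measurable_xperp i : measurable_fun (@B1 R) (fun x => xperp x i).
Proof.
apply: measurable_funTS; rewrite /xperp.
apply: measurable_funM.
  by case: (i == ord0); [apply: measurableT_comp => //; exact: measurable_snd|exact: measurable_fst].
(* At the origin both the inverse and the power are [0]. *)
rewrite (_ : (fun x => (enorm x)^-1) = fun x => enorm x `^ (-1)); last first.
  by apply/funext => x; rewrite powR_inv1 // sqrtr_ge0.
apply: (measurableT_comp (measurable_powR (-1))).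
apply: continuous_measurable2 => x; apply: continuous_comp; first exact: sqn_continuous.
exact: sqrt_continuous.
Qed.

Lemma xperp_sq x i j : xperp x i * xperp x j =
  (if i == ord0 then - x.2 else x.1) * (if j == ord0 then - x.2 else x.1) / (x.1 ^+ 2 + x.2 ^+ 2).
Proof.
rewrite /xperp /enorm /sqn; set s := _ + _; have s0 : 0 <= s by rewrite addr_ge0 ?sqr_ge0.
by rewrite -[in RHS](sqr_sqrtr s0) mulrACA expr2 invfM.
Qed.

Lemma xperp_bound x i j : `|xperp x i * xperp x j| <= 1.
Proof.
rewrite xperp_sq; case: x => u v /=.
have s0 : 0 <= u ^+ 2 + v ^+ 2 by rewrite addr_ge0 ?sqr_ge0.
have [->|s1] := eqVneq (u ^+ 2 + v ^+ 2) 0; first by rewrite invr0 mulr0 normr0.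
have s2 : 0 < u ^+ 2 + v ^+ 2 by rewrite lt_def s1.
rewrite normrM (gtr0_norm (_ : 0 < (u ^+ 2 + v ^+ 2)^-1)) ?invr_gt0 // ler_pdivrMr // mul1r.
have h1 := sqr_ge0 (u + v); have h2 := sqr_ge0 (u - v).
by case: (i == ord0); case: (j == ord0); rewrite ler_norml; nra.
Qed.

Variables (b m e : R).
Hypotheses (b_gt0 : 0 < b) (m_ge1 : 1 <= m) (e_gt0 : 0 < e) (e_le : e <= 8 * b).
Hypothesis bm_pi : b ^+ 2 * m * (576 / 35) = pi / 4.

Definition Ucomp i : R * R -> R := uncur (if i == ord0 then disp_u b m else disp_v b m).
Definition Wcomp : R * R -> R := uncur (capped b m e).

Lemma Ucomp_W12 i : W12 (Ucomp i) (fun j => pd j (Ucomp i)).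
Proof.
have [C [_ HC]] := disp_bound b m m_ge1.
rewrite /Ucomp; case: (i == ord0).
  apply: (proj1 (W12_uncur (disp_u b m) (disp_u_x b m) (disp_u_y b m) C _ _ _ _)).
  - by move=> u v; exact: dx_disp_u.
  - by move=> u v; exact: dy_disp_u.
  - by move=> u v; have [] := HC u v.
  - by move=> u v; have [] := HC u v.
apply: (proj1 (W12_uncur (disp_v b m) (disp_v_x b m) (disp_v_y b m) C _ _ _ _)).
- by move=> u v; exact: dx_disp_v.
- by move=> u v; exact: dy_disp_v.
- by move=> u v; have [] := HC u v.
- by move=> u v; have [] := HC u v.
Qed.

Let pdW i : pd i Wcomp = uncur (if i == ord0 then capped_x b m e else capped_y b m e).
Proof. by apply: pd_uncur => u v; [exact: dx_capped|exact: dy_capped]. Qed.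

Let ppdW i j : pd j (pd i Wcomp) = uncur (if i == ord0
  then (if j == ord0 then capped_xx b m e else capped_xy b m e)
  else (if j == ord0 then capped_xy b m e else capped_yy b m e)).
Proof.
rewrite pdW; case: (i == ord0).
  by apply: pd_uncur => u v; [exact: dx_capped_x|exact: dy_capped_x].
by apply: pd_uncur => u v; [exact: dx_capped_y|exact: dy_capped_y].
Qed.

Lemma Wcomp_W22 : W22 Wcomp (fun i => pd i Wcomp) (fun i j => pd j (pd i Wcomp)).
Proof.
have [[H1 H2] _] : W12 Wcomp (fun i => pd i Wcomp) /\ continuous Wcomp.
  apply: (W12_uncur _ (capped_x b m e) (capped_y b m e) (8 * b * m)).
  - by move=> u v; exact: dx_capped.
  - by move=> u v; exact: dy_capped.
  - by move=> u v; exact: capped_x_bound.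
  - by move=> u v; exact: capped_y_bound.
split; first exact: H1.
split; first exact: H2.
move=> i; rewrite pdW; case: (i == ord0).
  apply: (proj2 (proj1 (W12_uncur (capped_x b m e) (capped_xx b m e) (capped_xy b m e) (288 * (b * m) ^+ 2 / e) _ _ _ _))).
  - by move=> u v; exact: dx_capped_x.
  - by move=> u v; exact: dy_capped_x.
  - apply: hess_bound_of_low; [exact: e_gt0| |exact: capped_xx_bound].
  by move=> u v we; have [_ _ _ [-> _ _]] := capped_low b m e b_gt0 e_gt0 e_le u v we.
  - apply: hess_bound_of_low; [exact: e_gt0| |exact: capped_xy_bound].
  by move=> u v we; have [_ _ _ [_ -> _]] := capped_low b m e b_gt0 e_gt0 e_le u v we.
apply: (proj2 (proj1 (W12_uncur (capped_y b m e) (capped_xy b m e) (capped_yy b m e) (288 * (b * m) ^+ 2 / e) _ _ _ _))).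
- by move=> u v; exact: dx_capped_y.
- by move=> u v; exact: dy_capped_y.
- apply: hess_bound_of_low; [exact: e_gt0| |exact: capped_xy_bound].
  by move=> u v we; have [_ _ _ [_ -> _]] := capped_low b m e b_gt0 e_gt0 e_le u v we.
- apply: hess_bound_of_low; [exact: e_gt0| |exact: capped_yy_bound].
  by move=> u v we; have [_ _ _ [_ _ ->]] := capped_low b m e b_gt0 e_gt0 e_le u v we.
Qed.

(** The cutoff bounds the height on the whole plane, by [2 * (8 b) + e] from above and by
    [8 b + 2 e] from below; the hypothesis dominates both. *)
Lemma Wcomp_admissible (delta : R) : 16 * b + 2 * e <= 1 - delta -> W_admissible delta Wcomp.
Proof.
move=> bd; exists Wcomp; split.
  apply: continuous_subspaceT.
  apply: (proj2 (W12_uncur (capped b m e) (capped_x b m e) (capped_y b m e) (8 * b * m) _ _ _ _)).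
  - by move=> u v; exact: dx_capped.
  - by move=> u v; exact: dy_capped.
  - by move=> u v; exact: capped_x_bound.
  - by move=> u v; exact: capped_y_bound.
split; first exact: aeW.
split.
  have w0 : lens b m 0 0 <= e by rewrite lens00 ltW.
  by have [] := capped_low b m e b_gt0 e_gt0 e_le 0 0 w0.
move=> x _; rewrite /Wcomp /uncur /capped.
have d0 : 0 < 8 * b by rewrite mulr_gt0.
have := Phi0_bound e (8 * b) e_gt0 d0 _ (lens_ge0 b m b_gt0 m_ge1 x.1 x.2).
rewrite ler_norml; move: (Phi0 _ _ _) => p /andP[p1 p2]; have := b_gt0; have := e_gt0; lra.
Qed.

Definition density (h : R) x : R :=
  \sum_(i < 2) \sum_(j < 2)
    (pd j (Ucomp i) x + pd i (Ucomp j) x + pd i Wcomp x * pd j Wcomp x + xperp x i * xperp x j) ^+ 2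
  + h ^+ 2 * \sum_(i < 2) \sum_(j < 2) (pd j (pd i Wcomp) x) ^+ 2.

Definition strain_xx x : R :=
  2 * disp_u_x b m x.1 x.2 + capped_x b m e x.1 x.2 ^+ 2 + xperp x ord0 * xperp x ord0.
Definition strain_xy x : R := disp_u_y b m x.1 x.2 + disp_v_x b m x.1 x.2
  + capped_x b m e x.1 x.2 * capped_y b m e x.1 x.2 + xperp x ord0 * xperp x ord_max.
Definition strain_yy x : R :=
  2 * disp_v_y b m x.1 x.2 + capped_y b m e x.1 x.2 ^+ 2 + xperp x ord_max * xperp x ord_max.

Let pdU i j : pd j (Ucomp i) = uncur (if i == ord0
  then (if j == ord0 then disp_u_x b m else disp_u_y b m) else (if j == ord0 then disp_v_x b m else disp_v_y b m)).
Proof.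
rewrite /Ucomp; case: (i == ord0).
  by apply: pd_uncur => u v; [exact: dx_disp_u|exact: dy_disp_u].
by apply: pd_uncur => u v; [exact: dx_disp_v|exact: dy_disp_v].
Qed.

Lemma sum2 (F : 'I_2 -> R) : \sum_(i < 2) F i = F ord0 + F ord_max.
Proof.
by rewrite !big_ord_recl big_ord0 addr0; congr (_ + F _); exact: val_inj.
Qed.

Lemma densityE (h : R) x : density h x =
  strain_xx x ^+ 2 + 2 * strain_xy x ^+ 2 + strain_yy x ^+ 2
  + h ^+ 2 * (capped_xx b m e x.1 x.2 ^+ 2 + 2 * capped_xy b m e x.1 x.2 ^+ 2 + capped_yy b m e x.1 x.2 ^+ 2).
Proof.
have -> : density h x = \sum_(i < 2) \sum_(j < 2)
    (if i == ord0 then (if j == ord0 then strain_xx x else strain_xy x)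
     else (if j == ord0 then strain_xy x else strain_yy x)) ^+ 2
  + h ^+ 2 * \sum_(i < 2) \sum_(j < 2)
    (if i == ord0 then (if j == ord0 then capped_xx b m e x.1 x.2 else capped_xy b m e x.1 x.2)
     else (if j == ord0 then capped_xy b m e x.1 x.2 else capped_yy b m e x.1 x.2)) ^+ 2.
  congr (_ + _ * _); apply: eq_bigr => i _; apply: eq_bigr => j _; congr (_ ^+ 2).
    rewrite (pdU i j) (pdU j i) (pdW i) (pdW j) /uncur /strain_xx /strain_xy /strain_yy.
    case: (ord2P i) => ->; case: (ord2P j) => -> /=;
      move: (disp_u_x b m x.1 x.2) (disp_u_y b m x.1 x.2) (disp_v_x b m x.1 x.2) (disp_v_y b m x.1 x.2)
        (capped_x b m e x.1 x.2) (capped_y b m e x.1 x.2) => p q r s y z; ring.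
  rewrite (ppdW i j) /uncur.
  by case: (i == ord0); case: (j == ord0).
rewrite !sum2 /=.
move: (strain_xx x) (strain_xy x) (strain_yy x) (capped_xx b m e x.1 x.2) (capped_xy b m e x.1 x.2)
  (capped_yy b m e x.1 x.2) => p q r s y z.
by ring.
Qed.

Lemma strain_eq0 x : B1 x -> 3 * e <= lens b m x.1 x.2 ->
  [/\ strain_xx x = 0, strain_xy x = 0 & strain_yy x = 0].
Proof.
move=> Bx we; have := strain_free b m e b_gt0 m_ge1 e_gt0 x.1 x.2 Bx we.
rewrite /strain_xx /strain_xy /strain_yy !xperp_sq /=.
move: (disp_u_x b m x.1 x.2) (disp_u_y b m x.1 x.2) (disp_v_x b m x.1 x.2) (disp_v_y b m x.1 x.2)
  (capped_x b m e x.1 x.2) (capped_y b m e x.1 x.2) (x.1) (x.2) => p q r s y z u v [h1 h2 h3].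
by split; [rewrite -[RHS]h1|rewrite -[RHS]h3|rewrite -[RHS]h2]; ring.
Qed.

Lemma density_ge0 (h : R) x : 0 <= density h x.
Proof.
rewrite /density addr_ge0 //; last rewrite mulr_ge0 ?sqr_ge0 //;
  by apply: sumr_ge0 => i _; apply: sumr_ge0 => j _; exact: sqr_ge0.
Qed.

Lemma measurable_density (h : R) : measurable_fun (@B1 R) (density h).
Proof.
have mU i j : measurable_fun (@B1 R) (pd j (Ucomp i)) by have [_ /(_ j)[[]]] := Ucomp_W12 i.
have [_ [mW mWW]] := Wcomp_W22.
have mW1 i : measurable_fun (@B1 R) (pd i Wcomp) by have [[]] := mW i.
have mW2 i j : measurable_fun (@B1 R) (pd j (pd i Wcomp)) by have /(_ j)[[]] := mWW i.
apply: measurable_funD.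
  apply: measurable_sum => i; apply: measurable_sum => j; apply: measurable_funX.
  apply: measurable_funD; last by apply: measurable_funM; exact: measurable_xperp.
  apply: measurable_funD; last exact: measurable_funM.
  exact: measurable_funD.
apply: measurable_funM; first exact: measurable_cst.
by apply: measurable_sum => i; apply: measurable_sum => j; exact: measurable_funX.
Qed.

End Competitor.

(** * The energy density of the competitor *)

Section Bound.
Context {R : realType}.

Lemma sqr_le (a c : R) : `|a| <= c -> a ^+ 2 <= c ^+ 2.
Proof.
move=> ac; rewrite -(real_normK (num_real a)) lerXn2r ?nnegrE //.
exact: le_trans ac.
Qed.

(** Where the lens is at least [3 e] the strain vanishes and the weighted Hessian bounds control the
    bending. Elsewhere [3 b N <= lens < 3 e] confines the point to [N < e / b], a region of size
    [h], and a bound of order one suffices. *)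
Lemma density_bound (b m : R) : 0 < b -> 1 <= m -> b ^+ 2 * m * (576 / 35) = pi / 4 ->
  exists C : R, 0 <= C /\ forall h e x, 0 < h -> h = 8 * e -> e <= 8 * b -> B1 x ->
    density b m e h x <= C /\
    density b m e h x * Num.max `|x.1| `|x.2| ^+ 2 <= C * h ^+ 2.
Proof.
move=> b0 m1 bm; have [CU [CU0 HU]] := disp_bound b m m1.
pose G := 8 * b * m; pose H := 288 * (b * m) ^+ 2.
have G0 : 0 <= G by rewrite /G !mulr_ge0 //; lra.
have H0 : 0 <= H by exact: mulr_ge0 (ler0n _ _) (sqr_ge0 _).
(* Four strain entries, and four Hessian entries of size at most [H / e], each contributing
   [64 H ^+ 2] since [h = 8 e]. *)
have [A AE] : exists A : R, A = 4 * (2 * CU + G ^+ 2 + 1) ^+ 2 + 256 * H ^+ 2 by eexists.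
have A0 : 0 <= A by rewrite AE; apply: addr_ge0; exact: mulr_ge0 (ler0n _ _) (sqr_ge0 _).
have AH : 256 * H ^+ 2 <= A by rewrite AE lerDr; exact: mulr_ge0 (ler0n _ _) (sqr_ge0 _).
(* The second summand uses [N <= h / (8 b)] near the tip; the third comes from four Hessian entries,
   each at most [H / (3 b N)] away from it. *)
pose C := A + A / (64 * b ^+ 2) + 4 * H ^+ 2 / (9 * b ^+ 2).
have b2 : 0 < b ^+ 2 by rewrite exprn_gt0.
have C2 : 0 <= A / (64 * b ^+ 2) by rewrite divr_ge0 // mulr_ge0 // ltW.
have C3 : 0 <= 4 * H ^+ 2 / (9 * b ^+ 2).
  by rewrite divr_ge0 // mulr_ge0 ?sqr_ge0 // ltW.
exists C; split=> [|h e x h0 he eb Bx]; first by rewrite /C; lra.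
have e0 : 0 < e by lra.
set N := Num.max `|x.1| `|x.2|.
have N0 : 0 <= N by rewrite le_max normr_ge0.
have wN : 3 * b * N <= lens b m x.1 x.2 by exact: lens_ge.
set w := lens b m x.1 x.2 in wN.
have hh (r : R) : `|r| * w <= H -> `|r| <= H / e -> h ^+ 2 * r ^+ 2 <= 64 * H ^+ 2
    /\ (3 * e <= w -> h ^+ 2 * r ^+ 2 * N ^+ 2 <= h ^+ 2 * (H ^+ 2 / (9 * b ^+ 2))).
  move=> rw re; split.
    rewrite he; have := sqr_le _ _ re; rewrite expr_div_n ler_pdivlMr ?exprn_gt0 //.
    by move=> K; rewrite exprMn; lra.
  move=> w3; rewrite -mulrA ler_wpM2l ?sqr_ge0 //.
  rewrite ler_pdivlMr ?mulr_gt0 //.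
  have -> : r ^+ 2 * N ^+ 2 * (9 * b ^+ 2) = (r * (3 * b * N)) ^+ 2 by ring.
  apply: sqr_le; rewrite normrM (ger0_norm (_ : 0 <= 3 * b * N)).
    by rewrite (le_trans _ rw) // ler_wpM2l.
  by rewrite !mulr_ge0 // ltW.
have L (r : R) : (w <= e -> r = 0) -> `|r| * w <= H -> `|r| <= H / e.
  move=> r0 rw; case: (leP w e) => [/r0 ->|we].
    by rewrite normr0 divr_ge0 // ltW.
  by rewrite ler_pdivlMr // (le_trans _ rw) // ler_wpM2l // ltW.
have b11 := capped_xx_bound b m e b0 m1 e0 x.1 x.2.
have b12 := capped_xy_bound b m e b0 m1 e0 x.1 x.2.
have b22 := capped_yy_bound b m e b0 m1 e0 x.1 x.2.
have low : w <= e -> [/\ capped_xx b m e x.1 x.2 = 0, capped_xy b m e x.1 x.2 = 0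
    & capped_yy b m e x.1 x.2 = 0].
  by move=> we; have [_ _ _] := capped_low b m e b0 e0 eb x.1 x.2 we.
have [h11 n11] := hh _ b11 (L _ (fun we => let: And3 p _ _ := low we in p) b11).
have [h12 n12] := hh _ b12 (L _ (fun we => let: And3 _ p _ := low we in p) b12).
have [h22 n22] := hh _ b22 (L _ (fun we => let: And3 _ _ p := low we in p) b22).
rewrite densityE //; case: (leP (3 * e) w) => we.
  have [-> -> ->] := strain_eq0 b m e b0 m1 e0 x Bx we.
  rewrite !expr0n /= mulr0 !add0r.
  have {}n11 := n11 we; have {}n12 := n12 we; have {}n22 := n22 we.
  rewrite -[h ^+ 2 * _ * N ^+ 2]mulrA.
  move: (capped_xx _ _ _ _ _ ^+ 2) (capped_xy _ _ _ _ _ ^+ 2) (capped_yy _ _ _ _ _ ^+ 2)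
    h11 h12 h22 n11 n12 n22 => p q r h11 h12 h22 n11 n12 n22.
  have E : h ^+ 2 * (4 * H ^+ 2 / (9 * b ^+ 2)) = 4 * (h ^+ 2 * (H ^+ 2 / (9 * b ^+ 2))).
    by ring.
  split; first by rewrite !mulrDr (mulrCA (h ^+ 2)) /C; lra.
  have hA : 0 <= h ^+ 2 * A by rewrite mulr_ge0 ?sqr_ge0.
  have hC : 0 <= h ^+ 2 * (A / (64 * b ^+ 2)) by rewrite mulr_ge0 ?sqr_ge0.
  rewrite [C * _]mulrC /C !mulrDr E.
  have -> : h ^+ 2 * ((p + 2 * q + r) * N ^+ 2) =
    h ^+ 2 * p * N ^+ 2 + 2 * (h ^+ 2 * q * N ^+ 2) + h ^+ 2 * r * N ^+ 2 by ring.
  by lra.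
have [U1b U2b V1b V2b] := HU x.1 x.2.
have W1b := capped_x_bound b m e b0 m1 x.1 x.2.
have W2b := capped_y_bound b m e b0 m1 x.1 x.2.
rewrite -/G in W1b W2b.
have T (p q r s t : R) : `|p| <= CU -> `|q| <= CU -> `|r| <= G -> `|s| <= G -> `|t| <= 1 ->
    (p + q + r * s + t) ^+ 2 <= (2 * CU + G ^+ 2 + 1) ^+ 2.
  move=> hp hq hr hs ht; apply: sqr_le.
  have hrs : `|r * s| <= G ^+ 2 by rewrite normrM expr2 ler_pM.
  rewrite (le_trans (ler_normD _ _)) // lerD //.
  rewrite (le_trans (ler_normD _ _)) // lerD //.
  by rewrite (le_trans (ler_normD _ _)) //; lra.
have t1 : strain_xx b m e x ^+ 2 <= (2 * CU + G ^+ 2 + 1) ^+ 2.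
  have := T _ _ _ _ _ U1b U1b W1b W1b (xperp_bound x ord0 ord0).
  rewrite /strain_xx; move: (disp_u_x b m x.1 x.2) (capped_x b m e x.1 x.2) => p q.
  by rewrite (_ : p + p + q * q = 2 * p + q ^+ 2) //; ring.
have t2 : strain_xy b m e x ^+ 2 <= (2 * CU + G ^+ 2 + 1) ^+ 2.
  exact: T _ _ _ _ _ U2b V1b W1b W2b (xperp_bound x ord0 ord_max).
have t3 : strain_yy b m e x ^+ 2 <= (2 * CU + G ^+ 2 + 1) ^+ 2.
  have := T _ _ _ _ _ V2b V2b W2b W2b (xperp_bound x ord_max ord_max).
  rewrite /strain_yy; move: (disp_v_y b m x.1 x.2) (capped_y b m e x.1 x.2) => p q.
  by rewrite (_ : p + p + q * q = 2 * p + q ^+ 2) //; ring.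
move: (strain_xx b m e x) (strain_xy b m e x) (strain_yy b m e x) (capped_xx b m e x.1 x.2)
  (capped_xy b m e x.1 x.2) (capped_yy b m e x.1 x.2) t1 t2 t3 h11 h12 h22
  {n11 n12 n22 b11 b12 b22 low U1b U2b V1b V2b W1b W2b}
  => z11 z12 z22 p q r t1 t2 t3 h11 h12 h22.
set D := _ + h ^+ 2 * _.
have DA : D <= A by rewrite /D AE !mulrDr (mulrCA (h ^+ 2)); lra.
have D0 : 0 <= D.
  have K (y z t : R) : 0 <= y ^+ 2 + 2 * z ^+ 2 + t ^+ 2.
    by have := sqr_ge0 y; have := sqr_ge0 z; have := sqr_ge0 t; lra.
  apply: addr_ge0; first by have := K z11 z12 z22.
  by apply: mulr_ge0; [exact: sqr_ge0|have := K p q r].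
split; first by rewrite (le_trans DA) // /C; lra.
have N1 : (b * N) ^+ 2 * 64 <= h ^+ 2.
  have bN : 0 <= b * N by rewrite mulr_ge0 // ltW.
  have : (8 * (b * N)) ^+ 2 <= h ^+ 2.
    by apply: sqr_le; rewrite ger0_norm; lra.
  by rewrite exprMn; lra.
rewrite (le_trans (ler_wpM2r (sqr_ge0 N) DA)) //.
have N2 : A * N ^+ 2 <= A / (64 * b ^+ 2) * h ^+ 2.
  rewrite -mulrA ler_wpM2l // mulrC ler_pdivlMr ?mulr_gt0 //.
  by rewrite (le_trans _ N1) // exprMn; lra.
rewrite (le_trans N2) // ler_wpM2r ?sqr_ge0 // /C; lra.
Qed.

End Bound.

Theorem theorem1p2 (R : realType) :
  exists C : R, 0 < C /\
  forall h delta : R, 0 < h <= 1 / 2 -> 0 <= delta <= 1 / 2 ->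
  exists (U : 'I_2 -> R * R -> R) (DU : 'I_2 -> 'I_2 -> R * R -> R)
         (W : R * R -> R) (DW : 'I_2 -> R * R -> R)
         (D2W : 'I_2 -> 'I_2 -> R * R -> R),
    (forall i, W12 (U i) (DU i)) /\ W22 W DW D2W /\ W_admissible delta W /\
    (Etilde h DU DW D2W <= (C * h `^ (5 / 3))%:E)%E.
Proof.
(* [16 b = 1/4] together with [2 e <= 1/8] stays below [1/2 <= 1 - delta]; [m] solves the area
   condition for this [b]. *)
pose b : R := 1 / 64; pose m : R := 560 / 9 * pi.
have b0 : 0 < b by rewrite /b; lra.
have m1 : 1 <= m by rewrite /m; have := pi_ge2 R; lra.
have bm : b ^+ 2 * m * (576 / 35) = pi / 4 by rewrite /b /m; field.
have [C [C0 HC]] := density_bound b m b0 m1 bm.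
exists (28 * C + 1); split; first lra.
move=> h delta /andP[h0 h1] /andP[d0 d1].
pose e := h / 8.
have e0 : 0 < e by rewrite /e; lra.
have eb : e <= 8 * b by rewrite /e /b; lra.
exists (Ucomp b m), (fun i j => pd j (Ucomp b m i)), (Wcomp b m e), (fun i => pd i (Wcomp b m e)),
  (fun i j => pd j (pd i (Wcomp b m e))).
split; first by move=> i; apply: Ucomp_W12.
split; first by apply: Wcomp_W22.
split; first by apply: Wcomp_admissible => //; rewrite /e /b; lra.
(* With ratio [h ^ (1/n)] between layers the estimate yields [h ^ (2 - 2/n)]; [n = 6] is the choice
   that gives [5/3]. *)
pose t := h `^ (1 / 6).
have t0 : 0 < t by rewrite powR_gt0.
have tn (n : nat) : t ^+ n = h `^ (n%:R / 6).
  rewrite -powR_mulrn ?(ltW t0) // -powRrM; congr (_ `^ _); by field.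
have t6 : t ^+ 6 = h by rewrite tn divff // powRr1 // ltW.
have t10 : t ^+ 10 = h `^ (5 / 3) by rewrite tn; congr (_ `^ _); field.
have t1 : t <= 1.
  rewrite leNgt; apply/negP => t1.
  by have : 1 < t ^+ 6 by [rewrite exprn_egt1]; rewrite t6; lra.
apply: (@le_trans _ _ (28 * C * t ^+ 10)%:E); last first.
  rewrite t10 lee_fin ler_wpM2r ?powR_ge0 //; lra.
apply: (layered_integral (density b m e h)).
- exact: C0.
- by rewrite t0 t1.
- exact: measurable_density.
- by move=> x _; exact: density_ge0.
- by move=> x Bx; have [] := HC h e x h0 _ eb Bx; rewrite /e; first by field.
- move=> x Bx; rewrite t6.
  by have [] := HC h e x h0 _ eb Bx; rewrite /e; first by field.
Qed.
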